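(* Let $Y\in\mathbb{R}^n$ satisfy $Y=X\beta+\sigma\xi$ with a deterministic matrix $X\in\mathbb{R}^{n\times p}$ with columns $X_1,\dots,X_p$, $\sigma>0$ and $\xi\sim\mathcal{N}(0,\mathbb{I}_n)$. For any $a>0$, $q\ge1$ and $s<p$, for every $s'\in(0,s)$, $$\inf_{\hat\beta}\sup_{\beta\in\Omega^p_{s,a}}\mathbf{E}_\beta\big(\|\hat\beta-\beta\|_q^q\big)\ \ge\ a^q\frac{s'}{s}\Big(\frac{1}{2^q}\Psi(p,s,a,\sigma,X)-2s\,e^{-\frac{(s-s')^2}{2s}}\Big),$$ where the infimum is over all estimators $\hat\beta$.
   Context: $\Omega^p_{s,a}=\{\beta\in\mathbb{R}^p:\ |\beta|_0\le s\ \text{and}\ |\beta_i|\ge a\ \forall i\in S_\beta\}$, where $|\beta|_0$ is the number of nonzero entries and $S_\beta$ the set of indices of nonzero entries. $\mathbf{E}_\beta$ is expectation under the model with parameter $\beta$; $\|\cdot\|_q$ is the $\ell_q$ norm. With $\varepsilon$ a standard Gaussian random variable and $t_j(a):=\frac a2+\frac{\sigma^2\log(\frac ps-1)}{a\|X_j\|_2^2}$ for $j=1,\dots,p$, $$\Psi(p,s,a,\sigma,X):=\sum_{j=1}^p\Big(\frac sp\mathbf{P}\big(\sigma\varepsilon\ge(a-t_j(a))\|X_j\|_2\big)+\Big(1-\frac sp\Big)\mathbf{P}\big(\sigma\varepsilon\ge t_j(a)\|X_j\|_2\big)\Big).$$ *)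

(* Defs.v *)
From HB Require Import structures.
From mathcomp Require Import all_boot all_order all_algebra.
From mathcomp Require Import all_classical all_reals all_analysis.
Set Implicit Arguments. Unset Strict Implicit. Unset Printing Implicit Defensive.
Import Order.TTheory GRing.Theory Num.Theory.
Import numFieldNormedType.Exports.
Local Open Scope classical_set_scope.
Local Open Scope ring_scope.

Section defs.
Context {R : realType}.

Definition cV_borel (n : nat) : set (set 'cV[R]_n) :=
  smallest (@sigma_algebra _ setT)
    [set A | exists (j : 'I_n) (B : set R), measurable B /\
             A = (fun y : 'cV[R]_n => y j ord0) @^-1` B].

Definition estimator (n p : nat) (f : 'cV[R]_n -> 'cV[R]_p) : Prop :=
  forall (i : 'I_p) (B : set R), measurable B ->
    cV_borel ((fun y => f y i ord0) @^-1` B).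

Definition Omega (p : nat) (s : nat) (a : R) : set 'cV[R]_p :=
  [set b : 'cV[R]_p | (#|[set i : 'I_p | b i ord0 != 0%R]| <= s)%N /\
           (forall i : 'I_p, b i ord0 != 0 -> a <= `|b i ord0|)].

Definition col_norm (n p : nat) (X : 'M[R]_(n, p)) (j : 'I_p) : R :=
  Num.sqrt (\sum_(i < n) X i j ^+ 2).

Definition gtail (sigma c : R) : R :=
  fine (normal_prob 0 1 [set x : R | c <= sigma * x]).

Definition t_j (n p s : nat) (a sigma : R) (X : 'M[R]_(n, p)) (j : 'I_p) : R :=
  a / 2 + sigma ^+ 2 * ln (p%:R / s%:R - 1) / (a * col_norm X j ^+ 2).

Definition Psi (n p s : nat) (a sigma : R) (X : 'M[R]_(n, p)) : R :=
  \sum_(j < p)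
    ((s%:R / p%:R) * gtail sigma ((a - t_j s a sigma X j) * col_norm X j)
     + (1 - s%:R / p%:R) * gtail sigma (t_j s a sigma X j * col_norm X j)).

Definition iid_std_gaussian d (T : measurableType d) (P : probability T R)
  (n : nat) (xi : 'I_n -> T -> R) : Prop :=
  (forall i, measurable_fun setT (xi i)) /\
  (forall i (B : set R), measurable B ->
      P (xi i @^-1` B) = normal_prob 0 1 B) /\
  (forall B : 'I_n -> set R, (forall i, measurable (B i)) ->
      fine (P (\bigcap_(i in [set: 'I_n]) (xi i @^-1` B i)))
      = \prod_(i < n) fine (P (xi i @^-1` B i))).

Definition obs d (T : measurableType d) (n p : nat) (X : 'M[R]_(n, p))
  (sigma : R) (xi : 'I_n -> T -> R) (b : 'cV[R]_p) (w : T) : 'cV[R]_n :=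
  X *m b + sigma *: \col_(i < n) xi i w.

Definition risk d (T : measurableType d) (P : probability T R) (n p : nat)
  (X : 'M[R]_(n, p)) (sigma : R) (xi : 'I_n -> T -> R) (q : R)
  (f : 'cV[R]_n -> 'cV[R]_p) (b : 'cV[R]_p) : \bar R :=
  (\int[P]_w (\sum_(i < p) `|f (obs X sigma xi b w) i ord0 - b i ord0| `^ q)%:E)%E.

End defs.
Arguments Omega {R} p s a.

(* Main.v *)
Require Import Defs.
From HB Require Import structures.
From mathcomp Require Import all_boot all_order all_algebra.
From mathcomp Require Import all_classical all_reals all_analysis.
From mathcomp Require Import measurable_realfun ring lra.
Import Order.TTheory GRing.Theory Num.Theory.
Import numFieldNormedType.Exports.
Local Open Scope classical_set_scope.
Local Open Scope ring_scope.
Set Implicit Arguments.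
Unset Strict Implicit.
Unset Printing Implicit Defensive.

(** The risk dominates [(a / 2)^q] times the number of coordinates on which the
    test [a / 2 <= f_j] misidentifies the support.  Average it over the
    parameters [a * eta] with [eta] having i.i.d. Bernoulli([s' / p])
    coordinates, keeping only the [eta] with at most [s] ones.  For a fixed
    coordinate [j], pair [eta] (with [eta_j = 0]) with [eta + e_j]: both are
    admissible as soon as the other coordinates of [eta] contain fewer than [s]
    ones, which fails with probability at most [exp (- (s - s')^2 / (2 s))] by
    Chernoff's bound.  Each pair is a test between two Gaussian measures
    differing by the shift [a X_j]; by Neyman and Pearson its Bayes risk with
    weights [1 - s / p] and [s / p] is at least the [j]-th term of [Psi], and
    replacing [s] by [s'] in the weights costs a factor [s' / s].  The [j]-th
    term of [Psi] is at most [s / p], so the exceptional event costs at most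
    [s exp (- (s - s')^2 / (2 s))]. *)

(** * Transfer of integrals to image measures *)

Import HBNNSimple.

(** The hypothesis on indicators makes [nu] the image under [phi] of the measure with density [g].
    It extends to simple functions by linearity and to [f] by monotone convergence. A constant [g]
    gives a change of variables, [phi = id] integration against a density, and [g = 1] the law of a
    random variable. *)
Lemma ge0_integral_transfer d1 d2 (X : measurableType d1)
    (Y : measurableType d2) (R : realType) (mu : {measure set X -> \bar R})
    (nu : {measure set Y -> \bar R}) (phi : X -> Y) (g : X -> R)
    (f : Y -> \bar R) :
  measurable_fun setT phi -> measurable_fun setT g -> (forall x, 0 <= g x) ->
  (forall B, measurable B ->
    (\int[mu]_x ((g x)%:E * (\1_B (phi x))%:E) = nu B)%E) ->
  measurable_fun setT f -> (forall y, (0 <= f y)%E) ->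
  (\int[mu]_x ((g x)%:E * f (phi x)) = \int[nu]_y f y)%E.
Proof.
move=> mphi mg g0 gnu mf f0.
pose h := nnsfun_approx measurableT mf.
have mge : measurable_fun setT (fun x => (g x)%:E) by exact/measurable_EFinP.
have -> : (\int[nu]_y f y =
    lim (\int[nu]_y (EFin \o h n) y @[n --> \oo]))%E.
  have fE y : f y = lim ((EFin \o h n) y @[n --> \oo]).
    by apply/esym/cvg_lim => //; apply: cvg_nnsfun_approx.
  under eq_integral => y _ do rewrite fE.
  apply: monotone_convergence => //.
  - by move=> n; apply/measurable_EFinP; exact/measurable_funP.
  - by move=> n y _ /=; rewrite lee_fin.
  - by move=> y _ a b ab; rewrite lee_fin; exact/lefP/nd_nnsfun_approx.
have -> : (\int[mu]_x ((g x)%:E * f (phi x)) =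
    lim (\int[mu]_x ((g x)%:E * (h n (phi x))%:E) @[n --> \oo]))%E.
  have fE x : ((g x)%:E * f (phi x) =
      lim (((g x)%:E * (h n (phi x))%:E) @[n --> \oo]))%E.
    apply/esym/cvg_lim => //; apply: cvgeZl => //.
    by apply: cvg_nnsfun_approx.
  under eq_integral => y _ do rewrite fE.
  apply: monotone_convergence => //.
  - move=> n; apply: emeasurable_funM => //; apply/measurable_EFinP.
    by apply: measurableT_comp.
  - by move=> n x _; rewrite mule_ge0 ?lee_fin.
  - move=> x _ a b ab; rewrite lee_wpmul2l ?lee_fin//.
    by exact/lefP/nd_nnsfun_approx.
congr (limn _); apply/funext => n.
have mi r : measurable_fun setT
    (fun x => (r * \1_(h n @^-1` [set r]) (phi x))%:E).
  apply/measurable_EFinP; apply: measurable_funM => //.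
  by apply: measurableT_comp.
transitivity (\int[nu]_y
   (\sum_(r \in range (h n)) (r * \1_(h n @^-1` [set r]) y)%:E))%E; last first.
  by apply: eq_integral => t tE; rewrite /= fimfunE -fsumEFin.
rewrite ge0_integral_fsum//; last 2 first.
- move=> r; apply/measurable_EFinP; exact: measurable_funM.
- by move=> r y _; exact: nnfun_muleindic_ge0.
transitivity (\int[mu]_x (\sum_(r \in range (h n))
    (r * \1_(h n @^-1` [set r]) (phi x))%:E * (g x)%:E))%E.
  apply: eq_integral => x _.
  rewrite -ge0_mule_fsuml => [|r]; last exact: nnfun_muleindic_ge0.
  by rewrite fsumEFin // -(fimfunE _ (phi x)) muleC.
rewrite ge0_integral_fsum//; last 2 first.
- by move=> r; apply: emeasurable_funM.
- move=> r x _; apply: mule_ge0; last by rewrite lee_fin.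
  exact: nnfun_muleindic_ge0.
apply: eq_fsbigr => r rhn.
rewrite integralZl_indic_nnsfun //= integral_indic// setIT -gnu//.
have r0 : 0 <= r by move: rhn; rewrite inE => -[t _ <-].
rewrite -ge0_integralZl_EFin//.
- by apply: eq_integral => x _; rewrite EFinM -muleA; congr *%E; rewrite muleC.
- by move=> x _; rewrite mule_ge0 ?lee_fin.
- apply: emeasurable_funM => //; apply/measurable_EFinP.
  by apply: measurableT_comp.
Qed.

(** * Gaussian measures on the line *)

Lemma measurable_affine (R : realType) (c h : R) :
  measurable_fun [set: R] (fun x => c * x + h).
Proof. by apply: measurable_funD => //; apply: measurable_funM. Qed.

(** For a positive slope the left side is a measure that agrees with Lebesgue measure on half-open
    intervals, and uniqueness concludes. A negative slope reduces to this case by reflection. *)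
Lemma lebesgue_measure_affine (R : realType) (c h : R) (A : set R) :
  c != 0 -> measurable A ->
  (`|c|%:E * lebesgue_measure ((fun x => c * x + h)%R @^-1` A) =
   lebesgue_measure A)%E.
Proof.
have pos (k : R) (B : set R) : 0 < k -> measurable B ->
    (k%:E * lebesgue_measure ((fun x => k * x + h)%R @^-1` B) =
     lebesgue_measure B)%E.
  move=> k0 mB.
  pose f (x : measurableTypeR R) : measurableTypeR R := k * x + h.
  have mf : measurable_fun setT f by exact: measurable_affine.
  apply/esym; pose k' := NngNum (ltW k0).
  apply: (@lebesgue_measure_unique R
    (mscale k' (pushforward lebesgue_measure f))) => // _ [[a b] _ <-].
  transitivity (k%:E *
    lebesgue_measure ((fun x => k * x + h)%R @^-1` `]a, b]))%E; last by [].
  have -> : (fun x => k * x + h) @^-1` `]a, b] = `](a - h) / k, (b - h) / k]%classic.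
    apply/seteqP; split => x /=; rewrite !in_itv/=.
      by rewrite ltr_pdivrMr// ler_pdivlMr// ltrBlDr lerBrDr mulrC.
    by rewrite ltr_pdivrMr// ler_pdivlMr// ltrBlDr lerBrDr mulrC.
  rewrite !lebesgue_measure_itv/= !lte_fin ltr_pM2r ?invr_gt0// ltrD2r.
  case: ifPn => _; last by rewrite mule0.
  rewrite -!EFinD -EFinM; congr (_%:E); field.
  by rewrite gt_eqF.
move=> c0 mA; have [cp|cn] := ltP 0 c; first by rewrite gtr0_norm// pos.
have {}cn : c < 0 by rewrite lt_neqAle c0.
rewrite ltr0_norm// -(@pos (- c) A) ?oppr_gt0//; congr *%E.
rewrite -[RHS]lebesgue_measureN; last first.
  by rewrite -[X in measurable X]setTI; apply: measurable_affine.
rewrite /pushforward; congr (lebesgue_measure _).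
by apply/seteqP; split => x /=; rewrite mulrNN.
Qed.

Lemma ge0_integral_normal_prob (R : realType) (m s : R) (f : R -> \bar R) :
  measurable_fun setT f -> (forall y, (0 <= f y)%E) ->
  (\int[normal_prob m s]_x f x =
   \int[lebesgue_measure]_x ((normal_pdf m s x)%:E * f x))%E.
Proof.
move=> mf f0; apply/esym.
apply: (@ge0_integral_transfer _ _ _ _ _ lebesgue_measure
  (normal_prob m s) id) => //.
- exact: measurable_normal_pdf.
- by move=> x; exact: normal_pdf_ge0.
move=> B mB; rewrite /normal_prob [RHS]integral_mkcond.
by apply: eq_integral => x _; rewrite epatch_indic.
Qed.

Lemma normal_peak_scale (R : realType) (s : R) :
  0 < s -> normal_peak s = s^-1 * normal_peak 1.
Proof.
move=> s0; rewrite /normal_peak expr1n mul1r -mulrnAr sqrtrM ?sqr_ge0//.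
by rewrite sqrtr_sqr gtr0_norm// invfM.
Qed.

(** Change of variables with Jacobian [|c|]: this factor times the target density at [c * x + h] is
    the source density at [x]. *)
Lemma normal_prob_affine (R : realType) (m s c h : R) (B : set R) :
  0 < s -> c != 0 -> measurable B ->
  normal_prob m s ((fun x => c * x + h) @^-1` B) =
  normal_prob (c * m + h) (`|c| * s) B.
Proof.
move=> s0 c0 mB; have cn : 0 < `|c| by rewrite normr_gt0.
have mpre : measurable ((fun x => c * x + h) @^-1` B).
  by rewrite -[X in measurable X]setTI; apply: measurable_affine.
rewrite /normal_prob [RHS]integral_mkcond.
have := @ge0_integral_transfer _ _ _ _ R lebesgue_measure lebesgue_measure
  (fun x => c * x + h) (fun=> `|c|)
  ((fun x => (normal_pdf (c * m + h) (`|c| * s) x)%:E) \_ B).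
move=> <- //.
- rewrite [LHS]integral_mkcond; apply: eq_integral => x _.
  rewrite !epatch_indic /= muleA; congr (_ * _)%E.
  rewrite !normal_pdfE ?mulf_neq0 ?gt_eqF// -EFinM mulrA; congr (_ * _)%:E.
    rewrite (normal_peak_scale s0) (@normal_peak_scale _ (`|c| * s)) ?mulr_gt0//.
    by rewrite invfM mulrA mulrA divff ?mul1r// gt_eqF.
  rewrite /normal_fun; congr expR; rewrite exprMn real_normK ?num_real//.
  have -> : c * x + h - (c * m + h) = c * (x - m) by ring.
  rewrite exprMn; field.
  by rewrite c0 gt_eqF.
- exact: measurable_affine.
- move=> A mA; transitivity
      (`|c|%:E * lebesgue_measure ((fun x => c * x + h)%R @^-1` A))%E; last first.
    exact: lebesgue_measure_affine.
  have mA' : measurable ((fun x => c * x + h) @^-1` A).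
    by rewrite -[X in measurable X]setTI; apply: measurable_affine.
  rewrite ge0_integralZl_EFin//.
  + rewrite -[X in lebesgue_measure X]setIT -integral_indic//.
  + apply/measurable_EFinP; apply: measurableT_comp => //.
    exact: measurable_affine.
- apply: (measurable_restrictT _ _).1 => //; apply: measurable_funTS.
  by apply/measurable_EFinP; exact: measurable_normal_pdf.
- move=> y; rewrite epatch_indic mule_ge0// lee_fin//.
  exact: normal_pdf_ge0.
Qed.

(** Cameron-Martin formula in dimension one: the exponential is the density of the normal law of
    mean [h] with respect to the standard one. *)
Lemma normal_prob_shift (R : realType) (h : R) (B : set R) : measurable B ->
  (normal_prob 0 1 ((fun x => x + h)%R @^-1` B) =
   \int[normal_prob 0 1]_x (\1_B x * expR (h * x - h ^+ 2 / 2))%:E)%E.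
Proof.
move=> mB; have -> : (fun x => x + h) @^-1` B = (fun x => 1 * x + h) @^-1` B.
  by apply/seteqP; split => x /=; rewrite mul1r.
rewrite normal_prob_affine ?oner_eq0// mulr0 add0r normr1 mulr1.
rewrite ge0_integral_normal_prob; last first.
- by move=> y; rewrite lee_fin mulr_ge0// expR_ge0.
- apply/measurable_EFinP; apply: measurable_funM => //.
  apply: measurableT_comp => //; apply: measurable_affine.
rewrite /normal_prob integral_mkcond; apply: eq_integral => x _.
rewrite epatch_indic -!EFinM; congr (_%:E).
rewrite !normal_pdfE ?oner_eq0// /normal_fun -!mulrA; congr (_ * _).
rewrite mulrCA [LHS]mulrC; congr (_ * _); rewrite -expRD; congr expR.
by rewrite expr1n; field.
Qed.

(** Completing the square: the product of the densities of [y] and of [x]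
    given [y] is the density of [x] times the one of [y] given [x]. *)
Lemma normal_pdf_bayes (R : realType) (t c x y : R) : 0 < t ->
  let r := Num.sqrt (t ^+ 2 + c ^+ 2) in
  normal_pdf 0 1 y * normal_pdf (c * y) t x =
  normal_pdf 0 r x * normal_pdf (c * x / r ^+ 2) (t / r) y.
Proof.
move=> t0 r.
have r2 : r ^+ 2 = t ^+ 2 + c ^+ 2.
  by rewrite sqr_sqrtr// addr_ge0 ?sqr_ge0.
have r0 : 0 < r by rewrite sqrtr_gt0 ltr_wpDr ?sqr_ge0// exprn_gt0.
rewrite !normal_pdfE ?gt_eqF ?divr_gt0//.
rewrite (normal_peak_scale t0) (normal_peak_scale r0).
rewrite (@normal_peak_scale _ (t / r)) ?divr_gt0//.
rewrite [LHS]mulrACA [RHS]mulrACA; congr (_ * _).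
  by rewrite invf_div mulrACA -[in RHS]mulrA; field; rewrite !gt_eqF.
rewrite /normal_fun -!expRD; congr expR; rewrite expr1n !subr0.
have tne : t != 0 by rewrite gt_eqF.
have rne : r != 0 by rewrite gt_eqF.
have -> : t ^+ 2 = r ^+ 2 - c ^+ 2 by rewrite r2 addrK.
rewrite exprMn exprVn.
have -> : t ^+ 2 = r ^+ 2 - c ^+ 2 by rewrite r2 addrK.
have rc : r ^+ 2 - c ^+ 2 != 0 by rewrite r2 addrK expf_neq0.
field.
by rewrite rne.
Qed.

(** This is the law of a sum of independent centred Gaussians. After Tonelli, [normal_pdf_bayes]
    factors the joint density so that the integral in [y] is that of a probability density, hence
    1. *)
Lemma normal_prob_conv (R : realType) (t c : R) (B : set R) :
  0 < t -> measurable B ->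
  (\int[normal_prob 0 1]_y normal_prob 0 t ((fun x => x + c * y)%R @^-1` B) =
   normal_prob 0 (Num.sqrt (t ^+ 2 + c ^+ 2)) B)%E.
Proof.
move=> t0 mB; set r := Num.sqrt _.
have r0 : 0 < r by rewrite sqrtr_gt0 ltr_wpDr ?sqr_ge0// exprn_gt0.
pose F (z : R * R) := ((normal_pdf 0 1 z.1)%:E *
   ((normal_pdf (c * z.1) t z.2)%:E * (\1_B z.2)%:E))%E.
have shiftE y : normal_prob 0 t ((fun x => x + c * y)%R @^-1` B) =
    (\int[lebesgue_measure]_x ((normal_pdf (c * y) t x)%:E * (\1_B x)%:E))%E.
  have -> : (fun x => x + c * y) @^-1` B = (fun x => 1 * x + c * y) @^-1` B.
    by apply/seteqP; split => x /=; rewrite mul1r.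
  rewrite normal_prob_affine ?oner_eq0// mulr0 add0r normr1 mul1r.
  rewrite /normal_prob integral_mkcond; apply: eq_integral => x _.
  by rewrite epatch_indic.
have mpdf2 : measurable_fun setT
    (fun z : R * R => normal_pdf (c * z.1) t z.2).
  (* Joint measurability comes from moving the mean into the argument of a centred density. *)
  rewrite (_ : (fun _ => _) = (fun z : R * R => normal_pdf 0 t (z.2 - c * z.1))).
    apply: measurableT_comp; first exact: measurable_normal_pdf.
    apply: measurable_funB => //; apply: measurable_funM => //.
  apply/funext => z; rewrite !normal_pdfE ?gt_eqF//.
  by rewrite /normal_fun subr0.
have mF : measurable_fun setT F.
  apply/emeasurable_funM; last apply/emeasurable_funM.
  - apply/measurable_EFinP; apply: measurableT_comp => //.
    exact: measurable_normal_pdf.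
  - exact/measurable_EFinP.
  - by apply/measurable_EFinP; apply: measurableT_comp.
have F0 z : (0 <= F z)%E.
  by rewrite !mule_ge0 ?lee_fin ?normal_pdf_ge0.
transitivity (\int[lebesgue_measure]_y \int[lebesgue_measure]_x F (y, x))%E.
  under eq_integral do rewrite shiftE.
  rewrite ge0_integral_normal_prob; last 2 first.
  - apply: (@measurable_fun_fubini_tonelli_F _ _ _ _ R lebesgue_measure
      (fun z : R * R => ((normal_pdf (c * z.1) t z.2)%:E * (\1_B z.2)%:E)%E)).
    + apply/emeasurable_funM; first exact/measurable_EFinP.
      by apply/measurable_EFinP; apply: measurableT_comp.
    + by move=> z; rewrite mule_ge0 ?lee_fin ?normal_pdf_ge0.
  - move=> y; apply: integral_ge0 => x _.
    by rewrite mule_ge0 ?lee_fin ?normal_pdf_ge0.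
  apply: eq_integral => y _; rewrite -ge0_integralZl_EFin ?normal_pdf_ge0//.
  - by move=> x _; rewrite mule_ge0 ?lee_fin ?normal_pdf_ge0.
  - apply/emeasurable_funM; apply/measurable_EFinP => //.
    exact: measurable_normal_pdf.
rewrite (@fubini_tonelli _ _ _ _ R lebesgue_measure lebesgue_measure F)//.
rewrite /normal_prob [RHS]integral_mkcond; apply: eq_integral => x _.
rewrite epatch_indic /F /=.
transitivity (\int[lebesgue_measure]_y ((normal_pdf 0 r x * \1_B x)%:E *
   (normal_pdf (c * x / r ^+ 2) (t / r) y)%:E))%E.
  apply: eq_integral => y _; rewrite -!EFinM; congr (_%:E).
  by rewrite mulrA (normal_pdf_bayes c x y t0) -/r mulrAC.
rewrite ge0_integralZl_EFin//.
- by rewrite integral_normal_pdf mule1 EFinM.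
- by move=> y _; rewrite lee_fin normal_pdf_ge0.
- by apply/measurable_EFinP; exact: measurable_normal_pdf.
- by rewrite mulr_ge0// normal_pdf_ge0.
Qed.

(** * Gaussian vectors *)

Lemma sigma_algebra_cV_borel (R : realType) (n : nat) :
  sigma_algebra setT (@cV_borel R n).
Proof. exact: smallest_sigma_algebra. Qed.

Lemma cV_borel_preimage (R : realType) d (T : measurableType d) (n : nat)
    (Y : T -> 'cV[R]_n) (C : set 'cV[R]_n) :
  (forall i, measurable_fun setT (fun w => Y w i ord0)) ->
  cV_borel C -> measurable (Y @^-1` C).
Proof.
move=> mY.
suff : @cV_borel R n `<=` [set D | measurable (Y @^-1` D)] by exact.
apply: smallest_sub => [|_ [j [B [mB ->]]]]; last first.
  by rewrite /= -[X in measurable X]setTI; apply: (mY j).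
split => [|A mA|F mF].
- by rewrite /= preimage_set0.
- by rewrite /= setTD preimage_setC; exact: measurableC.
- by rewrite /= preimage_bigcup; apply: bigcupT_measurable => k; exact: mF.
Qed.

Section gaussian_vector.
Context (R : realType) d (T : measurableType d) (P : probability T R).
Context (n : nat) (xi : 'I_n -> T -> R).
Hypothesis hxi : iid_std_gaussian P xi.

Let mxi i : measurable_fun setT (xi i). Proof. by case: hxi. Qed.

Lemma iid_std_gaussian_rect (B : 'I_n -> set R) :
  (forall i, measurable (B i)) ->
  P [set w | forall i, B i (xi i w)] =
  (\prod_(i < n) fine (normal_prob 0 1 (B i)))%:E.
Proof.
move=> mB; case: hxi => _ [hN hI].
have -> : [set w | forall i, B i (xi i w)] =
    \bigcap_(i in [set: 'I_n]) (xi i @^-1` B i).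
  by apply/seteqP; split => w /= h i; [move=> _|]; exact: h.
have mcap : measurable (\bigcap_(i in [set: 'I_n]) (xi i @^-1` B i)).
  apply: fin_bigcap_measurable => // i _.
  by rewrite -[X in measurable X]setTI; exact: mxi.
rewrite -[LHS]fineK ?fin_num_measure// hI//; congr (_%:E).
by apply: eq_bigr => i _; rewrite hN.
Qed.

(** The statement carries the independence of the partial sum from the later coordinates, so that
    the induction can absorb these one at a time. The identically zero sum is kept apart because it
    has no Gaussian density. *)
Lemma iid_std_gaussian_partial_sum (u : 'I_n -> R) (k : nat) : (k <= n)%N ->
  let t2 := \sum_(i < n | (i < k)%N) u i ^+ 2 in
  let S w := \sum_(i < n | (i < k)%N) u i * xi i w in
  (t2 = 0 /\ forall w, S w = 0) \/
  (0 < t2 /\ forall A (B : 'I_n -> set R),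
    measurable A -> (forall i, measurable (B i)) ->
    P [set w | A (S w) /\ forall i : 'I_n, (k <= i)%N -> B i (xi i w)] =
    (fine (normal_prob 0 (Num.sqrt t2) A) *
     \prod_(i < n | (k <= i)%N) fine (normal_prob 0 1 (B i)))%:E).
Proof.
elim: k => [_ t2 S|k IH kn].
  by left; split=> [|w]; rewrite ?/t2 ?/S big_pred0.
pose k0 := Ordinal kn.
have splitlt (F : 'I_n -> R) : \sum_(i < n | (i < k.+1)%N) F i =
    F k0 + \sum_(i < n | (i < k)%N) F i.
  rewrite (bigD1 k0)//=; congr (_ + _); apply: eq_bigl => i.
  by rewrite -val_eqE /= ltnS ltn_neqAle andbC.
have splitge (F : 'I_n -> R) : \prod_(i < n | (k <= i)%N) F i =
    F k0 * \prod_(i < n | (k < i)%N) F i.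
  rewrite (bigD1 k0)//=; congr (_ * _); apply: eq_bigl => i.
  by rewrite -val_eqE /= ltn_neqAle andbC eq_sym.
move=> t2' S'; rewrite /t2' /S' splitlt.
pose t2 := \sum_(i < n | (i < k)%N) u i ^+ 2.
pose S w := \sum_(i < n | (i < k)%N) u i * xi i w.
have S'E w : S' w = u k0 * xi k0 w + S w by exact: splitlt.
rewrite -/t2; case: (IH (ltnW kn)); rewrite -/t2 -/S => -[].
  move=> -> S0'; have S0 w : S w = 0 by exact: S0'.
  rewrite addr0.
  (* The sum vanishes so far. Either it still does, or it becomes [u k0 * xi k0] and the event is a
     rectangle in the coordinates. *)
  have [uk0|uk0] := eqVneq (u k0) 0.
    left; split; first by rewrite uk0 expr0n.
    by move=> w; rewrite -/(S' w) S'E uk0 mul0r S0 addr0.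
  right; split; first by rewrite exprn_even_gt0.
  move=> A B mA mB; rewrite sqrtr_sqr.
  have mpA : measurable ((fun x => u k0 * x + 0) @^-1` A).
    by rewrite -[X in measurable X]setTI; exact: measurable_affine.
  pose B' i := if i == k0 then (fun x => u k0 * x + 0) @^-1` A else
    if (k < i)%N then B i else setT.
  have mB' i : measurable (B' i).
    by rewrite /B'; case: ifPn => // _; case: ifPn => // _; exact: mB.
  transitivity (P [set w | forall i, B' i (xi i w)]).
    congr (P _); apply/seteqP; split => w /=; rewrite -/(S' w) S'E S0.
      move=> [Aw Bw] i; rewrite /B'; case: ifPn => [/eqP -> //|ik].
      by case: ifPn => // ki; exact: Bw.
    move=> Bw; split; first by have := Bw k0; rewrite /B' eqxx.
    move=> i ki; have := Bw i; rewrite /B' ki; case: ifPn => // /eqP ik.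
    by move: ki; rewrite ik ltnn.
  rewrite iid_std_gaussian_rect// (bigD1 k0)//= {1}/B' eqxx.
  rewrite normal_prob_affine// mulr0 addr0 mulr1; congr ((_ * _)%:E).
  rewrite (bigID (fun i : 'I_n => (k < i)%N))/= [X in _ * X]big1 ?mulr1.
    apply: eq_big => [i|i /andP[ik ki]]; last by rewrite /B' (negbTE ik) ki.
    rewrite andbC; case: ltnP => //= ki.
    by apply/eqP => ik; move: ki; rewrite ik ltnn.
  move=> i /andP[ik ki]; rewrite /B' (negbTE ik) (negbTE ki).
  by rewrite probability_setT.
move=> t20 IHk; right; split; first by rewrite ltr_wpDl// sqr_ge0.
move=> A B mA mB.
(* [C] is the probability of [E], which constrains the coordinates after [k]. Restricted to [E], the
   joint law of [xi k0] and [S] is [C] times a product law: the induction hypothesis shows it on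
   rectangles, and uniqueness of product measures does the rest. *)
pose C := \prod_(i < n | (k < i)%N) fine (normal_prob 0 1 (B i)).
have C0 : 0 <= C by apply: prodr_ge0 => i _; exact: fine_ge0.
pose E := [set w | forall i : 'I_n, (k < i)%N -> B i (xi i w)].
have mE : measurable E.
  have -> : E = \bigcap_(i in [set i : 'I_n | (k < i)%N]) (xi i @^-1` B i).
    by apply/seteqP; split => w /= h i; exact: h.
  apply: fin_bigcap_measurable => // i _.
  by rewrite -[X in measurable X]setTI; exact: mxi.
have mS : measurable_fun setT S.
  rewrite /S; under eq_fun do rewrite big_mkcond/=.
  by apply: measurable_sum => i; case: (i < k)%N => //; apply: measurable_funM.
pose ph w : measurableTypeR R * measurableTypeR R := (xi k0 w, S w).
have mph : measurable_fun setT ph.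
  apply: (@measurable_fun_pair _ _ _ T (measurableTypeR R) (measurableTypeR R)
    (xi k0) S) => //; exact: mxi.
pose t := Num.sqrt t2.
have t0 : 0 < t by rewrite sqrtr_gt0.
pose m1 := mscale (NngNum C0) (normal_prob (0 : R) 1).
pose m2 := normal_prob (0 : R) t.
pose X := [set z : measurableTypeR R * measurableTypeR R | A (z.2 + u k0 * z.1)].
have mX : measurable X.
  rewrite -[X]setTI; apply: (_ : measurable_fun setT
    (fun z : R * R => z.2 + u k0 * z.1)) => //.
  by apply: measurable_funD => //; apply: measurable_funM.
have prodE : (m1 \x m2)%E X = pushforward (mrestr P mE) ph X.
  apply: (@product_measure_unique _ _ _ _ R m1 m2
    (pushforward (mrestr P mE) ph)) => //.
  move=> D F mD mF.
  pose B' i : set R := if i == k0 then (D : set R) else B i.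
  have mB' i : measurable (B' i).
    by rewrite /B'; case: ifPn => // _; exact: mB.
  transitivity (P [set w | F (S w) /\
      forall i : 'I_n, (k <= i)%N -> B' i (xi i w)]).
    congr (P _); apply/seteqP; split => w /=.
      move=> [[Dw Fw] Ew]; split => // i; rewrite leq_eqVlt /B'.
      case: ifPn => [/eqP -> //|ik /orP[|ki]]; last exact: Ew.
      by move: ik; rewrite -val_eqE /= eq_sym => /negbTE ->.
    move=> [Fw Bw]; split.
      by split => //; have := Bw k0 (leqnn k); rewrite /B' eqxx.
    move=> i ki; have := Bw i (ltnW ki); rewrite /B'; case: ifPn => // /eqP ik.
    by move: ki; rewrite ik ltnn.
  rewrite (IHk F B' mF mB') splitge {1}/B' eqxx.
  rewrite [X in _ * (_ * X)](_ : _ = C); last first.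
    apply: eq_bigr => i ki; rewrite /B'; case: ifPn => // /eqP ik.
    by move: ki; rewrite ik ltnn.
  rewrite -/t /m1 /m2 /mscale/= mulrC -mulrA mulrC mulrAC.
  by rewrite !EFinM !fineK ?fin_num_measure// [(C%:E * _)%E]muleC.
have -> : [set w | A (\sum_(i < n | (i < k.+1)%N) u i * xi i w) /\
    (forall i : 'I_n, (k < i)%N -> B i (xi i w))] = ph @^-1` X `&` E.
  by apply/seteqP; split => w /=; rewrite -/(S' w) S'E addrC.
rewrite -[P _]/((pushforward (mrestr P mE) ph) X) -prodE.
(* The section of [X] at [y] is the preimage of [A] under the translation by [u k0 * y], so the
   product measure of [X] is a Gaussian convolution. *)
rewrite /product_measure1 /m1 ge0_integral_mscale//=; last first.
  exact: measurable_fun_xsection.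
rewrite muleC EFinM; congr (_ * _)%E.
rewrite [u k0 ^+ 2 + _]addrC -[t2]sqr_sqrtr ?ltW// -/t.
rewrite fineK ?fin_num_measure// -normal_prob_conv//.
apply: eq_integral => y _ /=; congr (normal_prob _ _ _).
by apply/seteqP; split => x; rewrite /xsection /= inE.
Qed.

Lemma iid_std_gaussian_linear (u : 'I_n -> R) (A : set R) :
  0 < \sum_(i < n) u i ^+ 2 -> measurable A ->
  P [set w | A (\sum_(i < n) u i * xi i w)] =
  normal_prob 0 (Num.sqrt (\sum_(i < n) u i ^+ 2)) A.
Proof.
move=> u0 mA; have := iid_std_gaussian_partial_sum u (leqnn n).
have allE (F : 'I_n -> R) : \sum_(i < n | (i < n)%N) F i = \sum_(i < n) F i.
  by apply: eq_bigl => i; rewrite ltn_ord.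
rewrite allE => -[[t0 _]|[_ /(_ A (fun=> setT) mA)]].
  by rewrite t0 ltxx in u0.
rewrite [\prod_(i < n | _) _]big1 ?mulr1; last first.
  by move=> i _; rewrite probability_setT.
rewrite fineK ?fin_num_measure// => <- //; congr (P _).
by apply/seteqP; split => w /=; rewrite allE// => -[].
Qed.

Lemma ge0_expectation_prod_iid (g : 'I_n -> R -> R) (c : 'I_n -> R) :
  (forall i, measurable_fun setT (g i)) -> (forall i x, 0 <= g i x) ->
  (forall i, (\int[normal_prob 0 1]_x (g i x)%:E = (c i)%:E)%E) ->
  (\int[P]_w (\prod_(i < n) g i (xi i w))%:E = (\prod_(i < n) c i)%:E)%E.
Proof.
(* Replace one by one the indicators of a rectangle by the functions [g i]. *)
suff aux (k : nat) : (k <= n)%N ->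
    forall (g : 'I_n -> R -> R) (c : 'I_n -> R) (B : 'I_n -> set R),
    (forall i, measurable_fun setT (g i)) -> (forall i x, 0 <= g i x) ->
    (forall i, (\int[normal_prob 0 1]_x (g i x)%:E = (c i)%:E)%E) ->
    (forall i, measurable (B i)) ->
    (forall i : 'I_n, (k <= i)%N -> g i = \1_(B i)) ->
    (\int[P]_w (\prod_(i < n) g i (xi i w))%:E = (\prod_(i < n) c i)%:E)%E.
  move=> mg g0 gc; apply: (aux n _ g c (fun=> setT)) => // i.
  by rewrite leqNgt ltn_ord.
elim: k => [_|k IH kn] {}g {}c B mg g0 gc mB gB.
  have mrect : measurable [set w | forall i, B i (xi i w)].
    have -> : [set w | forall i, B i (xi i w)] =
        \bigcap_(i in [set: 'I_n]) (xi i @^-1` B i).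
      by apply/seteqP; split => w /= h i; [move=> _|]; exact: h.
    apply: fin_bigcap_measurable => // i _.
    by rewrite -[X in measurable X]setTI; exact: mxi.
  transitivity (P [set w | forall i, B i (xi i w)]).
    rewrite -[X in _ = P X]setIT -integral_indic//.
    apply: eq_integral => w _; congr (_%:E).
    rewrite indicE; have [|] := boolP (w \in _).
      rewrite inE => /= Bw; rewrite big1// => i _.
      by rewrite gB// indicE mem_set.
    move/negP => nB; have /existsNP[i Bi] : ~ forall i, B i (xi i w).
      by move=> Bw; apply: nB; rewrite inE.
    by rewrite (bigD1 i)//= gB// indicE memNset// mul0r.
  rewrite iid_std_gaussian_rect//; congr (_%:E).
  apply: eq_bigr => i _; apply: EFin_inj; rewrite -gc gB//.
  rewrite integral_indic//; last exact: mB.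
  by rewrite setIT fineK// fin_num_measure//; exact: mB.
pose k0 := Ordinal kn.
have c0 i : 0 <= c i.
  by rewrite -lee_fin -gc; apply: integral_ge0 => x _; rewrite lee_fin.
pose W w := \prod_(i < n | i != k0) g i (xi i w).
pose C := \prod_(i < n | i != k0) c i.
have C0 : 0 <= C by exact: prodr_ge0.
transitivity (\int[P]_w ((W w)%:E * (g k0 (xi k0 w))%:E))%E.
  by apply: eq_integral => w _; rewrite (bigD1 k0)//= mulrC EFinM.
(* The image under [xi k0] of the measure with density [W] is [C] times the standard normal law: on
   an indicator this is the induction hypothesis with [g k0] replaced by that indicator. *)
rewrite (@ge0_integral_transfer _ _ _ _ R P
  (mscale (NngNum C0) (normal_prob 0 1)) (xi k0) W
  (fun x => (g k0 x)%:E)) //.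
- rewrite ge0_integral_mscale//.
  + by rewrite gc (bigD1 k0)//= mulrC EFinM.
  + by apply/measurable_EFinP; exact: mg.
  + by move=> x _; rewrite lee_fin.
- exact: mxi.
- rewrite /W; under eq_fun do rewrite big_mkcond/=.
  apply: measurable_prod => i _; case: (i != k0) => //.
  exact: measurableT_comp.
- by move=> w; exact: prodr_ge0.
- move=> D mD.
  pose B' i : set R := if i == k0 then (D : set R) else B i.
  pose g' i : R -> R := if i == k0 then \1_(D : set R) else g i.
  pose c' i := if i == k0 then fine (normal_prob 0 1 D) else c i.
  transitivity (\int[P]_w (\prod_(i < n) g' i (xi i w))%:E)%E.
    apply: eq_integral => w _; rewrite (bigD1 k0)//= {1}/g' eqxx EFinM muleC.
    congr (_ * (_%:E))%E; apply: eq_bigr => i ik.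
    by rewrite /g' (negbTE ik).
  rewrite (IH (ltnW kn) g' c' B'); first last.
  + move=> i; rewrite /g' /B'; case: ifPn => // ik ki; apply: gB.
    by rewrite ltn_neqAle ki andbT eq_sym.
  + by move=> i; rewrite /B'; case: ifPn => // _; exact: mB.
  + move=> i; rewrite /g' /c'; case: ifPn => // _.
    by rewrite integral_indic// setIT fineK// fin_num_measure.
  + by move=> i x; rewrite /g'; case: ifPn.
  + by move=> i; rewrite /g'; case: ifPn => // _; exact: measurable_indic.
  rewrite (bigD1 k0)//= {1}/c' eqxx mulrC EFinM /mscale/=.
  rewrite fineK ?fin_num_measure//; congr ((_%:E) * _)%E.
  by apply: eq_bigr => i ik; rewrite /c' (negbTE ik).
- by apply/measurable_EFinP; exact: mg.
- by move=> x; rewrite lee_fin; exact: g0.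
Qed.

(** Cameron-Martin formula in dimension [n], with the product of the one-dimensional densities.
    Rectangles follow from independence; they are stable under intersection and generate [cV_borel],
    so Dynkin's lemma extends the identity. *)
Lemma gaussian_vector_shift (m h : 'I_n -> R) (sigma : R) (C : set 'cV[R]_n) :
  cV_borel C ->
  P [set w | C (\col_i (m i + sigma * (xi i w + h i)))] =
  (\int[P]_(w in [set w | C (\col_i (m i + sigma * xi i w))%R])
    (expR (\sum_(i < n) (h i * xi i w - h i ^+ 2 / 2)))%:E)%E.
Proof.
pose Y1 w : 'cV[R]_n := \col_i (m i + sigma * (xi i w + h i)).
pose Y0 w : 'cV[R]_n := \col_i (m i + sigma * xi i w).
pose L w := expR (\sum_(i < n) (h i * xi i w - h i ^+ 2 / 2)).
have mY1 i : measurable_fun setT (fun w => Y1 w i ord0).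
  under eq_fun do rewrite mxE.
  apply: measurable_funD => //; apply: measurable_funM => //.
  exact: measurable_funD.
have mY0 i : measurable_fun setT (fun w => Y0 w i ord0).
  under eq_fun do rewrite mxE.
  by apply: measurable_funD => //; apply: measurable_funM.
have mL : measurable_fun setT (fun w => (L w)%:E).
  apply/measurable_EFinP; apply: measurableT_comp => //.
  apply: measurable_sum => i.
  by apply: measurable_funB => //; apply: measurable_funM.
have L0 w : (0 <= (L w)%:E)%E by rewrite lee_fin expR_ge0.
rewrite -[P _]/(P (Y1 @^-1` C)) -[RHS]/(\int[P]_(w in Y0 @^-1` C) (L w)%:E)%E.
pose G := [set D : set 'cV[R]_n | exists B : 'I_n -> set R,
  (forall i, measurable (B i)) /\ D = [set y | forall i, B i (y i ord0)]].
pose H := [set D : set 'cV[R]_n | [/\ measurable (Y1 @^-1` D),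
  measurable (Y0 @^-1` D) &
  P (Y1 @^-1` D) = (\int[P]_(w in Y0 @^-1` D) (L w)%:E)%E]].
suff GH : G `<=` H.
  suff sH : <<s G >> `<=` H.
    move=> bC; suff /sH[] : <<s G >> C by [].
    move: C bC; apply: smallest_sub; first exact: smallest_sigma_algebra.
    move=> _ [j [B [mB ->]]].
    apply: sub_gen_smallest; exists (fun i => if i == j then B else setT).
    split => [i|]; first by case: ifP.
    apply/seteqP; split => [y By i /=|y /(_ j)]; last by rewrite /= eqxx.
    by case: ifPn => // /eqP ->.
  apply: lambda_system_subset => //.
    move=> _ _ [B [mB ->]] [D [mD ->]]; exists (fun i => B i `&` D i).
    split => [i|]; first exact: measurableI.
    apply/seteqP; split => y /=; first by move=> [yB yD] i; split.
    by move=> yBD; split=> i; have [] := yBD i.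
  have HT : H setT.
    by apply: GH; exists (fun=> setT); split => //; apply/seteqP; split.
  apply/dynkin_lambda_system; split => //.
    move=> D [mD1 mD0 DE]; split.
    - by rewrite preimage_setC; exact: measurableC.
    - by rewrite preimage_setC; exact: measurableC.
    (* For a complement, subtract the identity for [D] from the one for the whole space; finiteness
       of [P] makes this legitimate. *)
    have := HT; rewrite /H /= !preimage_setT => -[_ _].
    rewrite -(setUv (Y0 @^-1` D)) ge0_integral_setU//; first last.
    - by apply/disj_setPS; rewrite setICr.
    - by apply: measurable_funTS.
    - exact: measurableC.
    rewrite setUv -(setUv (Y1 @^-1` D)) measureU ?setICr//; last first.
      exact: measurableC.
    rewrite (preimage_setC Y1) (preimage_setC Y0).
    have : P (Y1 @^-1` D) \is a fin_num by rewrite fin_num_measure.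
    move: DE; set a := P (Y1 @^-1` D).
    set b := integral P (Y0 @^-1` D) _.
    set a' := P (~` (Y1 @^-1` D)); set b' := integral P _ _.
    move=> <- afin /(congr1 (fun z => z - a)%E).
    by rewrite [(a + a')%E]addeC [(a + b')%E]addeC !addeK.
  move=> F tF HF.
  have mF1 i : measurable (Y1 @^-1` F i) by have [] := HF i.
  have mF0 i : measurable (Y0 @^-1` F i) by have [] := HF i.
  have tF' (Y : T -> 'cV[R]_n) : trivIset setT (fun i => Y @^-1` F i).
    apply/trivIsetP => i j _ _ ij; rewrite -preimage_setI.
    by move/trivIsetP : tF => /(_ _ _ _ _ ij) ->//; rewrite preimage_set0.
  split.
  - by rewrite preimage_bigcup; exact: bigcupT_measurable.
  - by rewrite preimage_bigcup; exact: bigcupT_measurable.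
  rewrite !preimage_bigcup measure_bigcup// ge0_integral_bigcup//.
    rewrite (eq_eseriesl (Q := xpredT)); last by move=> i; rewrite in_setT.
    by apply: eq_eseriesr => i _; have [] := HF i.
  by apply: measurable_funTS.
move=> _ [B [mB ->]].
(* [B0] and [B1] are the constraints on the noise, for the unshifted and the shifted vector
   respectively. *)
pose B0 i := (fun x => sigma * x + m i) @^-1` B i.
pose B1 i := (fun x => x + h i) @^-1` B0 i.
have mB0 i : measurable (B0 i).
  by rewrite -[X in measurable X]setTI; apply: measurable_affine.
have mB1 i : measurable (B1 i).
  by rewrite -[X in measurable X]setTI; apply: measurable_funD.
have mcap (Y : T -> 'cV[R]_n) : (forall i, measurable_fun setT
    (fun w => Y w i ord0)) ->
    measurable (Y @^-1` [set y | forall i, B i (y i ord0)]).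
  move=> mY; rewrite (_ : _ @^-1` _ = \bigcap_(i in [set: 'I_n])
    ((fun w => Y w i ord0) @^-1` B i)); last first.
    by apply/seteqP; split => w /= wB i; [move=> _|]; exact: wB.
  apply: fin_bigcap_measurable => // i _.
  by rewrite -[X in measurable X]setTI; apply: mY.
split; [exact: mcap|exact: mcap|].
transitivity (P [set w | forall i, B1 i (xi i w)]).
  congr (P _); apply/seteqP.
  by split => w /= wB i; have := wB i; rewrite /B1 /B0 /= mxE addrC.
rewrite iid_std_gaussian_rect//.
rewrite integral_mkcond; apply/esym.
rewrite -(ge0_expectation_prod_iid
  (g := fun i x => \1_(B0 i) x * expR (h i * x - h i ^+ 2 / 2))).
- apply: eq_integral => w _.
  rewrite epatch_indic -EFinM; congr (_%:E).
  rewrite big_split/= /L expR_sum mulrC; congr (_ * _).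
  rewrite indicE; have [|] := boolP (w \in _).
    rewrite inE => /= Bw; rewrite big1// => i _.
    by rewrite indicE mem_set//; have := Bw i; rewrite /B0 /= mxE addrC.
  move/negP => nB; have /existsNP[i Bi] : ~ forall i, B0 i (xi i w).
    move=> Bw; apply: nB; rewrite inE /= => i.
    by have := Bw i; rewrite /B0 /= mxE addrC.
  by rewrite (bigD1 i)//= indicE memNset// mul0r.
- move=> i; apply: measurable_funM; first exact: measurable_indic.
  by apply: measurableT_comp => //; exact: measurable_affine.
- by move=> i x; rewrite mulr_ge0// expR_ge0.
- move=> i; rewrite -normal_prob_shift; last exact: mB0.
  by rewrite fineK// fin_num_measure//; exact: mB1.
Qed.

End gaussian_vector.

(** * Testing two shifts of a Gaussian vector *)

(** The weighted error of a region is the integral of a function equal to [u] on the region and to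
    [v * L] off it. Deciding by [u <= v * L] selects the smaller value at every point. *)
Lemma neyman_pearson (R : realType) d (T : measurableType d)
    (mu : {measure set T -> \bar R}) (L : T -> R) (u v : R) (S : set T) :
  measurable_fun setT L -> (forall w, 0 <= L w) -> 0 <= u -> 0 <= v ->
  measurable S ->
  (u%:E * mu [set w | (u <= v * L w)%R] +
     v%:E * (\int[mu]_(w in ~` [set w | (u <= v * L w)%R]) (L w)%:E) <=
   u%:E * mu S + v%:E * (\int[mu]_(w in ~` S) (L w)%:E))%E.
Proof.
move=> mL L0 u0 v0 mS; set A := [set w | _].
have mA : measurable A.
  rewrite -[A]setTI.
  rewrite (_ : A = (fun w => v * L w) @^-1` `[u, +oo[).
    by apply: measurable_funM.
  by apply/seteqP; split => w /=; rewrite in_itv/= andbT.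
have mEL : measurable_fun setT (fun w => (L w)%:E) by exact/measurable_EFinP.
have riskE (D : set T) : measurable D ->
    (u%:E * mu D + v%:E * (\int[mu]_(w in ~` D) (L w)%:E) =
     \int[mu]_w (u * \1_D w + v * (L w * \1_(~` D) w))%:E)%E.
  move=> mD; under [RHS]eq_integral do rewrite EFinD (EFinM u) (EFinM v).
  have mDL : measurable_fun setT (fun w => (L w * \1_(~` D) w)%:E).
    apply/measurable_EFinP/measurable_funM => //.
    exact/measurable_indic/measurableC.
  have DL0 w : (0 <= (L w * \1_(~` D) w)%:E)%E by rewrite lee_fin mulr_ge0.
  rewrite ge0_integralD//; last 4 first.
  - by move=> w _; rewrite mule_ge0 ?lee_fin.
  - by apply: measurable_funeM; exact/measurable_EFinP/measurable_indic.
  - by move=> w _; rewrite mule_ge0// lee_fin.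
  - exact: measurable_funeM.
  rewrite !ge0_integralZl_EFin//; last first.
    exact/measurable_EFinP/measurable_indic.
  rewrite integral_indic// setIT; congr (_ + _ * _)%E.
  rewrite integral_mkcond; apply: eq_integral => w _.
  by rewrite epatch_indic EFinM.
rewrite !riskE//.
have mrisk (D : set T) : measurable D -> measurable_fun setT
    (fun w => (u * \1_D w + v * (L w * \1_(~` D) w))%:E).
  move=> mD; apply/measurable_EFinP/measurable_funD.
    by apply: measurable_funM => //; exact: measurable_indic.
  apply: measurable_funM => //; apply: measurable_funM => //.
  exact/measurable_indic/measurableC.
apply: ge0_le_integral => //; try exact: mrisk.
- by move=> w _; rewrite lee_fin addr_ge0 ?mulr_ge0.
move=> w _; rewrite lee_fin !indicE !in_setC.
have [/set_mem wA|] := boolP (w \in A); case: (w \in S);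
  rewrite /= ?mulr1 ?mulr0 ?addr0 ?add0r//.
by rewrite notin_setE /A /= => /negP; rewrite -ltNge => /ltW.
Qed.

Lemma normal_prob_set1 (R : realType) (m s x : R) :
  normal_prob m s [set x] = 0%E.
Proof. by rewrite /normal_prob integral_set1. Qed.

(** Reflection gives the open half-line, and the missing endpoint is a null set. *)
Lemma normal_prob_tail_opp (R : realType) (x : R) :
  normal_prob 0 1 [set y : R | y < x] = normal_prob 0 1 [set y : R | - x <= y].
Proof.
have mlt : measurable [set y : R | y < x].
  by rewrite (_ : [set _ | _] = `]-oo, x[%classic)//; apply/seteqP; split => y;
    rewrite /= in_itv.
have -> : [set y : R | - x <= y] =
    (fun y => (-1) * y + 0) @^-1` [set y : R | y < x] `|` [set - x].
  apply/seteqP; split => y /=; rewrite addr0 mulN1r ltrNl.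
    by rewrite le_eqVlt => /orP[/eqP ->|->]; [right|left].
  by move=> [/ltW|->].
apply/esym; transitivity (normal_prob 0 1 ((fun y => (-1) * y + 0)%R @^-1`
    [set y | y < x]%R) + normal_prob 0 1 [set (- x)%R])%E.
  apply: measureU => //.
    by rewrite -[X in measurable X]setTI; apply: measurable_affine.
  apply/seteqP; split => y //= -[+ yx].
  by rewrite yx addr0 mulN1r opprK ltxx.
have n1 : - 1 != 0 :> R by rewrite oppr_eq0 oner_eq0.
rewrite normal_prob_set1 adde0 (normal_prob_affine 0 0 ltr01 n1 mlt).
by rewrite mulr0 add0r normrN1 mulr1.
Qed.

(** The likelihood ratio is a function of one standard normal variable [Z], so the optimal test
    compares [Z] with a threshold, namely [c]. Without the shift it errs when [c <= Z]; under the
    shift [Z] gains [tau] and the error is the tail at [tau - c]. *)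
Lemma gaussian_two_point (R : realType) d (T : measurableType d)
    (P : probability T R) (n : nat) (xi : 'I_n -> T -> R) (m h : 'I_n -> R)
    (sigma tau pi : R) (C : set 'cV[R]_n) :
  iid_std_gaussian P xi -> 0 < tau -> \sum_(i < n) h i ^+ 2 = tau ^+ 2 ->
  0 < pi < 1 -> cV_borel C ->
  forall c, c = tau / 2 + ln ((1 - pi) / pi) / tau ->
  ((1 - pi)%:E * normal_prob 0 1 [set x | c <= x]%R +
     pi%:E * normal_prob 0 1 [set x | tau - c <= x]%R <=
   (1 - pi)%:E * P [set w | C (\col_i (m i + sigma * xi i w))%R] +
     pi%:E * P [set w | ~ C (\col_i (m i + sigma * (xi i w + h i)))%R])%E.
Proof.
move=> hxi tau0 htau /andP[pi0 pi1] bC c cdef.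
have mxi i : measurable_fun setT (xi i) by case: hxi.
pose Z w := \sum_(i < n) (h i / tau) * xi i w.
pose L w := expR (tau * Z w - tau ^+ 2 / 2).
have mZ : measurable_fun setT Z.
  by apply: measurable_sum => i; apply: measurable_funM.
have mL : measurable_fun setT L.
  apply: measurableT_comp => //; apply: measurable_funB => //.
  exact: measurable_funM.
have LE w : expR (\sum_(i < n) (h i * xi i w - h i ^+ 2 / 2)) = L w.
  congr expR; rewrite sumrB -[X in _ - X]mulr_suml htau; congr (_ - _).
  rewrite mulr_sumr; apply: eq_bigr => i _; field.
  by rewrite gt_eqF.
have lawZ (A : set R) : measurable A -> P (Z @^-1` A) = normal_prob 0 1 A.
  move=> mA; have sumh : \sum_(i < n) (h i / tau) ^+ 2 = 1.
    under eq_bigr do rewrite exprMn.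
    by rewrite -mulr_suml htau -exprMn divff ?expr1n// gt_eqF.
  have := iid_std_gaussian_linear hxi (u := fun i => h i / tau) _ mA.
  by rewrite sumh sqrtr1; apply.
have bC' : cV_borel (~` C).
  rewrite -setTD.
  by have [_ + _] := sigma_algebra_cV_borel R n; apply.
set S := [set w | C (\col_i (m i + sigma * xi i w))].
have mS : measurable S.
  apply: cV_borel_preimage bC => i; under eq_fun do rewrite mxE.
  by apply: measurable_funD => //; apply: measurable_funM.
have -> : P [set w | ~ C (\col_i (m i + sigma * (xi i w + h i)))] =
    (\int[P]_(w in ~` S) (L w)%:E)%E.
  rewrite (gaussian_vector_shift hxi m h sigma bC').
  by apply: eq_integral => w _; rewrite LE.
have := neyman_pearson P mL (fun w => expR_ge0 _) _ (ltW pi0) mS.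
move=> /(_ (1 - pi)); rewrite subr_ge0 (ltW pi1) => /(_ isT).
(* Taking logarithms: [c] is the value of [Z] at which [pi * L] equals [1 - pi]. *)
have cE w : (1 - pi <= pi * L w) = (c <= Z w).
  rewrite -ler_pdivrMl// mulrC -(ler_ln (R := R)) ?posrE ?expR_gt0//; last first.
    by rewrite divr_gt0// subr_gt0.
  rewrite expRK lerBrDr cdef -[RHS](ler_pM2l tau0).
  congr (_ <= _); field.
  by rewrite gt_eqF.
have mge : measurable [set x : R | c <= x].
  by rewrite (_ : [set _ | _] = `[c, +oo[%classic)//; apply/seteqP; split => y;
    rewrite /= in_itv/= andbT.
have mlt : measurable [set x : R | x < c].
  by rewrite (_ : [set _ | _] = `]-oo, c[%classic)//; apply/seteqP; split => y;
    rewrite /= in_itv.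
have -> : [set w | 1 - pi <= pi * L w] = Z @^-1` [set x | c <= x].
  by apply/seteqP; split => w /=; rewrite cE.
apply: le_trans; apply: leeD.
  by rewrite -(lawZ [set x | c <= x]).
apply: lee_wpmul2l; first by rewrite lee_fin ltW.
have -> : ~` (Z @^-1` [set x | c <= x]) = Z @^-1` [set x | x < c].
  by apply/seteqP; split => w /=; rewrite ltNge => /negP.
(* The integrand depends on the noise through [Z] only, so the integral moves to the line, where the
   density stands for a shift by [tau]. *)
have -> : (\int[P]_(w in Z @^-1` [set x | (x < c)%R]) (L w)%:E =
    \int[P]_w (1%:E *
      (\1_[set x | (x < c)%R] (Z w) * expR (tau * Z w - tau ^+ 2 / 2))%:E))%E.
  rewrite integral_mkcond; apply: eq_integral => w _.
  by rewrite epatch_indic mul1e -EFinM mulrC.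
rewrite (@ge0_integral_transfer _ _ _ _ R P (normal_prob 0 1) Z (fun=> 1)
  (fun x => (\1_[set x | x < c] x * expR (tau * x - tau ^+ 2 / 2))%:E)) //.
- rewrite -normal_prob_shift//.
  have -> : (fun x => x + tau) @^-1` [set x | x < c] = [set y | y < c - tau].
    by apply/seteqP; split => y /=; rewrite ltrBrDr.
  by rewrite normal_prob_tail_opp opprB.
- move=> B mB; under eq_integral do rewrite mul1e.
  transitivity (P (Z @^-1` B)); last exact: lawZ.
  rewrite -[X in P X]setIT -integral_indic//.
  by rewrite -[X in measurable X]setTI; apply: mZ.
- apply/measurable_EFinP; apply: measurable_funM.
    exact: measurable_indic.
  by apply: measurableT_comp => //; exact: measurable_affine.
Qed.

(** * The Bernoulli prior *)

(** The left side is 1 at 0 and its derivative is [- u ^+ 2] times the exponential. For [u < 1] this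
    is the bound of [ln (1 - u)] by [- u - u ^+ 2 / 2], which turns the Chernoff bound into a
    Gaussian one. *)
Lemma onem_expR_le1 (R : realType) (u : R) : 0 <= u ->
  (1 - u) * expR (u + u ^+ 2 / 2) <= 1.
Proof.
move=> u0; pose g (x : R) := (1 - x) * expR (x + x ^+ 2 / 2).
pose g' (x : R) := - (x ^+ 2 * expR (x + x ^+ 2 / 2)).
have dg (x : R) : is_derive x 1 g (g' x).
  apply: is_derive_eq; rewrite /g' !scaler0 add0r /GRing.scale /=.
  by field.
suff : g u <= g 0.
  by rewrite {2}/g subr0 mul1r expr0n /= mul0r addr0 expR0.
apply: (@ler0_derive1_nincr R g 0 u) => //.
- move=> x _; rewrite derive1E; case: (dg x) => _ ->.
  by rewrite /g' oppr_le0 mulr_ge0 ?sqr_ge0 ?expR_ge0.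
- apply: continuous_subspaceT => x; apply: differentiable_continuous.
  by apply/derivable1_diffP; case: (dg x).
Qed.

Lemma sum_set_notin (R : comRingType) (I : finType) (j : I) (x y : R) :
  \sum_(A : {set I} | j \notin A) \prod_(i | i != j) (if i \in A then x else y) =
  (x + y) ^+ (#|I|.-1).
Proof.
(* With weights 0 and 1 at [j], expanding the product kills the subsets containing [j] and leaves
   the other terms unchanged. *)
pose F i := if i == j then 0 else x.
pose G i := if i == j then 1 else y.
transitivity (\prod_i (F i + G i)); last first.
  rewrite (bigD1 j)//= {1}/F {1}/G eqxx add0r mul1r.
  rewrite (eq_bigr (fun=> x + y)); last by move=> i ij; rewrite /F /G (negbTE ij).
  rewrite prodr_const; congr (_ ^+ _).
  by rewrite (cardC1 j).
rewrite bigA_distr [RHS](bigID (fun A : {set I} => j \in A))/=.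
rewrite [X in _ = X + _]big1 ?add0r.
  apply: eq_big => // A jA.
  rewrite [RHS](bigD1 j)//= (negbTE jA) {1}/G eqxx mul1r.
  by apply: eq_bigr => i ij; rewrite /F /G (negbTE ij).
by move=> A jA; rewrite (bigD1 j)//= jA {1}/F eqxx mul0r.
Qed.

(** Inserting [j] is a bijection, inverse to removing it. It raises the cardinality by one, hence
    the strict bound on the right. *)
Lemma sum_set_in (R : zmodType) (I : finType) (j : I) (k : nat)
    (F : {set I} -> R) :
  \sum_(A : {set I} | (j \in A) && (#|A| <= k)%N) F A =
  \sum_(A : {set I} | (j \notin A) && (#|A| < k)%N) F (j |: A).
Proof.
rewrite (reindex_onto (fun A : {set I} => j |: A) (fun A => A :\ j))/=.
  apply: eq_bigl => A; rewrite finset.setU11 /=.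
  have [jA|jA] := boolP (j \in A); last by rewrite finset.setU1K// eqxx andbT cardsU1 jA.
  apply/negbTE; rewrite negb_and; apply/orP; right.
  by apply: contraL jA => /eqP <-; rewrite finset.setD11.
by move=> A /andP[jA _]; rewrite finset.setD1K.
Qed.

Section bernoulli_prior.
Context (R : realType) (p s : nat) (s' : R).
Hypotheses (s'0 : 0 < s') (s's : s' < s%:R) (sp : (s < p)%N).

Let p0 : 0 < p%:R :> R. Proof. by rewrite ltr0n (leq_ltn_trans _ sp). Qed.
Let s0 : 0 < s%:R :> R. Proof. exact: lt_trans s'0 s's. Qed.
Let spR : s%:R < p%:R :> R. Proof. by rewrite ltr_nat. Qed.

Let delta : R := expR (- (s%:R - s') ^+ 2 / (2 * s%:R)).

(** Exponential Markov inequality with tilt [s / s']: when [#|A|] is at least [s], the factor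
    [s / s'] to the power [#|A| - s] is at least 1. The tilted weights sum to a power of
    [1 + (s - s') / p], at most [expR (s - s')], and [onem_expR_le1] at [u = 1 - s' / s] gives the
    exponent. *)
Lemma chernoff_tail (j : 'I_p) :
  \sum_(A : {set 'I_p} | (j \notin A) && (s <= #|A|)%N)
    \prod_(i < p | i != j) (if i \in A then s' / p%:R else 1 - s' / p%:R) <=
  delta.
Proof.
have r1 : 1 <= s%:R / s' by rewrite ler_pdivlMr// mul1r ltW.
have pi1 : 0 <= 1 - s' / p%:R.
  by rewrite subr_ge0 ler_pdivrMr// mul1r ltW// (lt_trans s's).
have pi0 : 0 <= s' / p%:R by rewrite divr_ge0 ?ltW.
apply: (@le_trans _ _ ((s' / s%:R) ^+ s * \sum_(A : {set 'I_p} | j \notin A)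
    \prod_(i < p | i != j) (if i \in A then s%:R / p%:R else 1 - s' / p%:R))).
  rewrite mulr_sumr big_mkcondr; apply: ler_sum => A jA.
  have -> : \prod_(i < p | i != j)
      (if i \in A then s%:R / p%:R else 1 - s' / p%:R) =
      (s%:R / s') ^+ #|A| * \prod_(i < p | i != j)
      (if i \in A then s' / p%:R else 1 - s' / p%:R).
    have -> : (s%:R / s') ^+ #|A| =
        \prod_(i < p | i != j) (if i \in A then s%:R / s' else 1).
      rewrite -big_mkcondr/= -prodr_const; apply: eq_bigl => i.
      by case: eqVneq => //= ->; rewrite (negbTE jA).
    rewrite -big_split/=; apply: eq_bigr => i _; case: ifP => _.
      by field; rewrite !gt_eqF.
    by rewrite mul1r.
  have prod0 : 0 <= \prod_(i < p | i != j)
      (if i \in A then s' / p%:R else 1 - s' / p%:R).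
    by apply: prodr_ge0 => i _; case: ifP.
  rewrite mulrA; case: ifPn => sA; last first.
    by rewrite !mulr_ge0// exprn_ge0// divr_ge0// ltW.
  apply: ler_peMl => //; rewrite -(subnKC sA) exprD mulrA -exprMn.
  have -> : s' / s%:R * (s%:R / s') = 1 by field; rewrite !gt_eqF.
  rewrite expr1n mul1r.
  exact: exprn_ege1.
rewrite sum_set_notin card_ord.
have -> : s%:R / p%:R + (1 - s' / p%:R) = 1 + (s%:R - s') / p%:R.
  by rewrite mulrBl; ring.
apply: (@le_trans _ _ ((s' / s%:R) ^+ s * expR (s%:R - s'))).
  apply: ler_wpM2l; first by rewrite exprn_ge0// divr_ge0// ltW.
  (* Only [p - 1] coordinates remain; as the base is at least 1, the exponent may be raised to
     [p]. *)
  have e1 : 1 <= 1 + (s%:R - s') / p%:R.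
    by rewrite lerDl divr_ge0// ?ltW// subr_gt0.
  apply: (@le_trans _ _ ((1 + (s%:R - s') / p%:R) ^+ p)).
    by apply: ler_weXn2l => //; exact: leq_pred.
  have -> : expR (s%:R - s') = expR ((s%:R - s') / p%:R) ^+ p.
    by rewrite -expRM_natl mulrC divfK// gt_eqF.
  apply: lerXn2r; rewrite ?nnegrE ?expR_ge0 ?expR_ge1Dx//.
  by rewrite (le_trans ler01).
have u0 : 0 <= 1 - s' / s%:R by rewrite subr_ge0 ler_pdivrMr// mul1r ltW.
have := onem_expR_le1 u0; set u := 1 - s' / s%:R => le1.
have -> : s' / s%:R = 1 - u by rewrite /u subKr.
rewrite /delta.
(* In terms of [u] both sides are [s]-th powers, of [(1 - u) * expR u] and of
   [expR (- (u ^+ 2 / 2))]. *)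
have -> : s%:R - s' = s%:R * u.
  by rewrite /u mulrBr mulr1 mulrC divfK// gt_eqF.
have -> : - (s%:R * u) ^+ 2 / (2 * s%:R) = s%:R * (- (u ^+ 2 / 2)).
  by field; rewrite gt_eqF.
rewrite !expRM_natl -exprMn; apply: lerXn2r; rewrite ?nnegrE ?expR_ge0//.
  by rewrite mulr_ge0 ?expR_ge0// /u subKr divr_ge0// ltW.
by rewrite expRN -[_^-1]mul1r ler_pdivlMr ?expR_gt0// -mulrA -expRD.
Qed.

(** The averaging in abstract form: [err A j] stands for the probability of misjudging [j] when the
    support is [A], and [B j] for the optimal two-point risk at [j]. In the proof, [w] is the prior
    and [v j] the prior on the coordinates other than [j]. *)
Lemma bernoulli_prior_bound (err : {set 'I_p} -> 'I_p -> R) (B : 'I_p -> R)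
    (M : R) :
  (forall A j, 0 <= err A j) -> (forall j, 0 <= B j <= s%:R / p%:R) ->
  (forall (A : {set 'I_p}) j, j \notin A ->
    B j <= (1 - s%:R / p%:R) * err A j + s%:R / p%:R * err (j |: A) j) ->
  (forall A : {set 'I_p}, (#|A| <= s)%N -> \sum_(j < p) err A j <= M) ->
  s' / s%:R * (\sum_(j < p) B j - s%:R * delta) <= M.
Proof.
move=> err0 hB pairB hM.
pose x := s' / p%:R.
have pi1 : 0 <= 1 - x.
  by rewrite subr_ge0 ler_pdivrMr// mul1r ltW// (lt_trans s's).
have pi0 : 0 <= x by rewrite divr_ge0 ?ltW.
pose w (A : {set 'I_p}) : R := \prod_(i < p) (if i \in A then x else 1 - x).
pose v j (A : {set 'I_p}) : R :=
  \prod_(i < p | i != j) (if i \in A then x else 1 - x).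
have w0 A : 0 <= w A by apply: prodr_ge0 => i _; case: ifP.
have v0 j A : 0 <= v j A by apply: prodr_ge0 => i _; case: ifP.
have w1 : \sum_(A : {set 'I_p}) w A = 1.
  have := bigA_distr (1 : R) +%R (fun=> x) (fun _ : 'I_p => 1 - x).
  by rewrite big1 => [<-//|i _]; rewrite /= addrC subrK.
have wnotin j (A : {set 'I_p}) : j \notin A -> w A = (1 - x) * v j A.
  by move=> jA; rewrite /w (bigD1 j)//= (negbTE jA).
have win j (A : {set 'I_p}) : j \notin A -> w (j |: A) = x * v j A.
  move=> jA; rewrite /w (bigD1 j)//= finset.setU11; congr (_ * _).
  by apply: eq_bigr => i ij; rewrite finset.in_setU1 (negbTE ij).
have v1 j : 1 - delta <= \sum_(A : {set 'I_p} | (j \notin A) && (#|A| < s)%N) v j A.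
  have : \sum_(A : {set 'I_p} | j \notin A) v j A = 1.
    by rewrite sum_set_notin subrKC expr1n.
  rewrite (bigID (fun A : {set 'I_p} => #|A| < s)%N)/= => E1.
  rewrite lerBlDr -[leLHS]E1 lerD2l.
  under eq_bigl do rewrite -leqNgt.
  exact: chernoff_tail.
(* The prior restricted to at most [s] ones has mass at most 1, so bounding the average by [M]
   requires [M] to be nonnegative; the empty support shows it. *)
have M0 : 0 <= M.
  apply: le_trans (hM finset.set0 _); last by rewrite cards0.
  exact: sumr_ge0.
have avg : \sum_(A : {set 'I_p} | (#|A| <= s)%N) w A * \sum_(j < p) err A j <= M.
  apply: (@le_trans _ _ (\sum_(A : {set 'I_p} | (#|A| <= s)%N) w A * M)).
    by apply: ler_sum => A sA; apply: ler_wpM2l => //; exact: hM.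
  rewrite -mulr_suml ler_piMl// -w1 [leRHS](bigID (fun A : {set 'I_p} =>
    #|A| <= s)%N)/= lerDl.
  exact: sumr_ge0.
have coord j : s' / s%:R * (B j * (1 - delta)) <=
    \sum_(A : {set 'I_p} | (#|A| <= s)%N) w A * err A j.
  have /andP[Bj0 _] := hB j.
  have r0 : 0 <= s' / s%:R by rewrite divr_ge0 ?ltW.
  rewrite (bigID (fun A : {set 'I_p} => j \in A))/=.
  under eq_bigl do rewrite andbC.
  rewrite sum_set_in addrC.
  under eq_bigl do rewrite andbC.
  (* Sets of exactly [s] elements avoiding [j] have no admissible partner and are dropped. *)
  apply: (@le_trans _ _ (\sum_(A : {set 'I_p} | (j \notin A) && (#|A| < s)%N)
      w A * err A j + \sum_(A : {set 'I_p} | (j \notin A) && (#|A| < s)%N)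
      w (j |: A) * err (j |: A) j)); last first.
    rewrite lerD2r [leRHS](bigID (fun A : {set 'I_p} => #|A| < s)%N)/=.
    rewrite [X in _ <= X + _](eq_bigl (fun A : {set 'I_p} =>
      (j \notin A) && (#|A| < s)%N)); last first.
      by move=> A; rewrite -andbA; congr (_ && _); rewrite andbC;
        case: ltnP => //= /ltnW ->.
    by rewrite lerDl; apply: sumr_ge0 => A _; rewrite mulr_ge0.
  rewrite -big_split/=; apply: (@le_trans _ _ (\sum_(A : {set 'I_p} |
      (j \notin A) && (#|A| < s)%N) v j A * (s' / s%:R * B j))).
    rewrite -mulr_suml mulrA [leRHS]mulrC; apply: ler_wpM2l.
      exact: mulr_ge0.
    exact: v1.
  apply: ler_sum => A /andP[jA _]; rewrite (wnotin _ _ jA) (win _ _ jA).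
  have -> : (1 - x) * v j A * err A j + x * v j A * err (j |: A) j =
    v j A * ((1 - x) * err A j + x * err (j |: A) j) by ring.
  apply: ler_wpM2l => //.
  (* Comparison of weights: [s' / p] is [s' / s] times [s / p], while [s' / s] times [1 - s / p]
     equals [s' / s - s' / p], at most [1 - s' / p]. *)
  apply: (@le_trans _ _ (s' / s%:R * ((1 - s%:R / p%:R) * err A j +
      s%:R / p%:R * err (j |: A) j))).
    by apply: ler_wpM2l => //; exact: pairB.
  rewrite mulrDr; apply: lerD.
    rewrite mulrA; apply: ler_wpM2r => //.
    rewrite mulrBr mulr1 mulrA divfK ?gt_eqF// -/x lerD2r.
    by rewrite ler_pdivrMr// mul1r ltW.
  by rewrite mulrA mulrA divfK ?gt_eqF.
apply: le_trans avg; under [leRHS]eq_bigr do rewrite mulr_sumr.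
rewrite [leRHS]exchange_big/=.
apply: (@le_trans _ _ (\sum_(j < p) s' / s%:R * (B j * (1 - delta)))); last first.
  by apply: ler_sum => j _; exact: coord.
rewrite -mulr_sumr; apply: ler_wpM2l; first by rewrite divr_ge0 ?ltW.
rewrite -mulr_suml mulrBr mulr1 lerD2l lerN2; apply: ler_wpM2r.
  exact: expR_ge0.
apply: (@le_trans _ _ (\sum_(j < p) s%:R / p%:R)).
  by apply: ler_sum => j _; have /andP[] := hB j.
by rewrite sumr_const card_ord -[leLHS]mulr_natr divfK// gt_eqF.
Qed.

End bernoulli_prior.

(** * The regression model *)

Section model.
Context (R : realType) d (T : measurableType d) (P : probability T R).
Context (n p : nat) (X : 'M[R]_(n, p)) (sigma : R) (xi : 'I_n -> T -> R).
Hypotheses (sigma0 : 0 < sigma) (hxi : iid_std_gaussian P xi).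

Let mxi i : measurable_fun setT (xi i). Proof. by case: hxi. Qed.

Lemma obsE (b : 'cV[R]_p) w :
  obs X sigma xi b w = \col_i ((X *m b) i ord0 + sigma * xi i w).
Proof. by apply/matrixP => i j; rewrite !mxE ord1. Qed.

Lemma measurable_obs_coord (b : 'cV[R]_p) i :
  measurable_fun setT (fun w => obs X sigma xi b w i ord0).
Proof.
under eq_fun do rewrite obsE mxE.
by apply: measurable_funD => //; apply: measurable_funM.
Qed.

(** * Testing a single coordinate of the parameter *)

Section two_point.
Context (a : R) (s : nat).
Hypotheses (a0 : 0 < a) (s0 : (0 < s)%N) (sp : (s < p)%N).

(** This is [gaussian_two_point] for the weight [s / p] and the noise shift [a / sigma] times the
    column [j], of norm [tau]. Multiplied by [sigma], the thresholds [c] and [tau - c] become the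
    two arguments of [gtail] in [Psi]. *)
Lemma bayes_le_test (j : 'I_p) (b : 'cV[R]_p) (C : set 'cV[R]_n) :
  0 < col_norm X j -> cV_borel C ->
  s%:R / p%:R * gtail sigma ((a - t_j s a sigma X j) * col_norm X j) +
  (1 - s%:R / p%:R) * gtail sigma (t_j s a sigma X j * col_norm X j) <=
  (1 - s%:R / p%:R) * fine (P [set w | C (obs X sigma xi b w)]) +
  s%:R / p%:R *
    fine (P [set w | ~ C (obs X sigma xi (b + a *: delta_mx j ord0) w)]).
Proof.
move=> K0 bC.
have p0 : 0 < p%:R :> R by rewrite ltr0n (leq_ltn_trans _ sp).
have sR0 : 0 < s%:R :> R by rewrite ltr0n.
have pi0 : 0 < s%:R / p%:R :> R by rewrite divr_gt0.
have pi1 : s%:R / p%:R < 1 :> R by rewrite ltr_pdivrMr// mul1r ltr_nat.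
pose tau := a * col_norm X j / sigma.
have tau0 : 0 < tau by rewrite divr_gt0// mulr_gt0.
pose c := tau / 2 + ln ((1 - s%:R / p%:R) / (s%:R / p%:R)) / tau.
have oddsE : (1 - s%:R / p%:R) / (s%:R / p%:R) = p%:R / s%:R - 1 :> R.
  by field; rewrite !gt_eqF.
have tE : t_j s a sigma X j * col_norm X j = sigma * c.
  rewrite /t_j /c /tau oddsE; field.
  by rewrite !gt_eqF.
have atE : (a - t_j s a sigma X j) * col_norm X j = sigma * (tau - c).
  rewrite mulrBl tE mulrBr /tau; congr (_ - _); field.
  by rewrite gt_eqF.
have gtailE x : gtail sigma (sigma * x) = fine (normal_prob 0 1 [set y | x <= y]).
  rewrite /gtail; congr (fine (normal_prob _ _ _)).
  by apply/seteqP; split => y /=; rewrite ler_pM2l.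
rewrite tE atE !gtailE addrC.
pose h i := a / sigma * X i j.
have hh : \sum_(i < n) h i ^+ 2 = tau ^+ 2.
  under eq_bigr do rewrite exprMn.
  have -> : tau = a / sigma * col_norm X j by rewrite /tau mulrAC.
  rewrite -mulr_sumr [RHS]exprMn; congr (_ * _).
  by rewrite /col_norm sqr_sqrtr// sumr_ge0// => i _; rewrite sqr_ge0.
have := gaussian_two_point (fun i => (X *m b) i ord0) sigma hxi tau0 hh _ bC
  (erefl c).
rewrite pi0 pi1 => /(_ isT).
have E0 : [set w | C (\col_i ((X *m b) i ord0 + sigma * xi i w))] =
    [set w | C (obs X sigma xi b w)].
  by apply/seteqP; split => w /=; rewrite obsE.
have E1 : [set w | ~ C (\col_i ((X *m b) i ord0 + sigma * (xi i w + h i)))] =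
    [set w | ~ C (obs X sigma xi (b + a *: delta_mx j ord0) w)].
  suff H w : \col_i ((X *m b) i ord0 + sigma * (xi i w + h i)) =
      obs X sigma xi (b + a *: delta_mx j ord0) w.
    by apply/seteqP; split => w /=; rewrite H.
  rewrite obsE; apply/matrixP => i k.
  rewrite mulmxDr -scalemxAr -colE !mxE /h mulrDr [LHS]addrA [RHS]addrAC.
  congr (_ + _ + _).
  by field; rewrite gt_eqF.
rewrite E0 E1.
have mC b' : measurable [set w | C (obs X sigma xi b' w)].
  apply: (cV_borel_preimage (Y := obs X sigma xi b')) bC => i.
  exact: measurable_obs_coord.
have mC' b' : measurable [set w | ~ C (obs X sigma xi b' w)].
  exact: (measurableC (mC b')).
have mge x : measurable [set y : R | x <= y].
  by rewrite (_ : [set _ | _] = `[x, +oo[%classic)//; apply/seteqP; split => y;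
    rewrite /= in_itv/= andbT.
set u := 1 - _; set v := s%:R / p%:R.
rewrite -lee_fin !EFinD !EFinM !fineK ?fin_num_measure//.
- exact: mge.
- exact: mge.
Qed.

End two_point.

Lemma measurable_estimator_obs (f : 'cV[R]_n -> 'cV[R]_p) (b : 'cV[R]_p) j :
  estimator f -> measurable_fun setT (fun w => f (obs X sigma xi b w) j ord0).
Proof.
move=> ef _ B mB; rewrite setTI.
apply: (cV_borel_preimage (Y := obs X sigma xi b) _ (ef j B mB)) => i.
exact: measurable_obs_coord.
Qed.

Lemma measurable_loss (f : 'cV[R]_n -> 'cV[R]_p) (b : 'cV[R]_p) (q : R) :
  estimator f -> measurable_fun setT (fun w =>
    (\sum_(i < p) `|f (obs X sigma xi b w) i ord0 - b i ord0| `^ q)%:E).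
Proof.
move=> ef; apply/measurable_EFinP; apply: measurable_sum => i.
apply: (@measurableT_comp _ _ _ _ _ _ (fun x : R => x `^ q)).
  exact: measurable_powR.
apply: measurableT_comp => //; apply: measurable_funB => //.
exact: measurable_estimator_obs.
Qed.

(** If [X_j = 0] then [t_j] divides by [0] and the [j]-th term of [Psi] is
    [1 / 2] instead of its limit [min (s / p) (1 - s / p)].  This is harmless:
    the law of the observation does not depend on the unbounded [j]-th
    coordinate of the parameter, so that the maximal risk is infinite. *)
Lemma risk_zero_column (f : 'cV[R]_n -> 'cV[R]_p) (a q : R) (s : nat)
    (j : 'I_p) :
  estimator f -> (0 < s)%N -> 0 < a -> 1 <= q -> col_norm X j = 0 ->
  ereal_sup [set risk P X sigma xi q f b | b in Omega p s a] = +oo%E.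
Proof.
move=> ef s0 a0 q1 K0.
have X0 i : X i j = 0.
  apply/eqP; rewrite -sqrf_eq0; apply/eqP.
  have sq0 k : true -> 0 <= X k j ^+ 2 by rewrite sqr_ge0.
  have S0 : \sum_(k < n) X k j ^+ 2 = 0.
    apply/eqP; rewrite eq_le sumr_ge0// andbT -sqrtr_eq0.
    exact/eqP.
  by have /psumr_eq0P := S0; apply.
pose b (t : R) : 'cV[R]_p := t *: delta_mx j ord0.
have obsb t w : obs X sigma xi (b t) w = obs X sigma xi 0 w.
  rewrite /obs /b -scalemxAr -colE mulmx0; congr (_ + _).
  by apply/matrixP => i k; rewrite !mxE X0 mulr0.
pose g w := f (obs X sigma xi 0 w) j ord0.
have mg : measurable_fun setT g by exact: measurable_estimator_obs.
pose E (M : nat) := [set w | `|g w| <= M%:R].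
have mE M : measurable (E M).
  rewrite (_ : E M = g @^-1` `[- M%:R, M%:R]).
    by rewrite -[X in measurable X]setTI; apply: mg.
  by apply/seteqP; split => w; rewrite /E /= in_itv/= ler_norml.
(* Otherwise, by continuity from below, the union of the [E M], which is the whole space, would have
   probability at most 1/2. *)
have [M PM] : exists M, (2^-1%:E <= P (E M))%E.
  apply: contrapT => /forallNP noM.
  have : (P (\bigcup_M E M) <= 2^-1%:E)%E.
    have ndE : nondecreasing_seq E.
      move=> k l kl; apply/subsetPset => w; rewrite /E /= => /le_trans; apply.
      by rewrite ler_nat.
    have cvgE := nondecreasing_cvg_mu (mu := P) mE (bigcupT_measurable _ mE) ndE.
    rewrite -(cvg_lim _ cvgE)//; apply: lime_le; first by apply: cvgP cvgE.
    by apply: nearW => k; have /negP := noM k; rewrite -ltNge => /ltW.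
  suff -> : \bigcup_M E M = setT.
    by rewrite probability_setT lee_fin leNgt invf_lt1// ltr1n.
  apply/seteqP; split => // w _; exists (Num.truncn `|g w|).+1 => //.
  by rewrite /E /= ltW// truncnS_gt.
apply/eqyP => N _.
(* The bound [a <= t] makes [b t] admissible. On [E M] the error is at least the maximum of 1 and
   [2 * N]: being at least 1, it is dominated by its [q]-th power, and the factor 2 offsets the
   probability 1/2. *)
pose t := Num.max a (M%:R + Num.max 1 (2 * N)).
have tM : M%:R + Num.max 1 (2 * N) <= t by rewrite le_max lexx orbT.
have t0 : 0 < t by rewrite lt_max a0.
have bt : Omega p s a (b t).
  have bE i : b t i ord0 = if i == j then t else 0.
    by rewrite !mxE eqxx andbT; case: eqP => _; rewrite ?mulr1 ?mulr0.
  split; last first.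
    move=> i; rewrite bE; case: ifP => _; last by rewrite eqxx.
    by move=> _; rewrite gtr0_norm// le_max lexx.
  apply: leq_trans s0; rewrite -[X in (_ <= X)%N](finset.cards1 j).
  apply: subset_leq_card; apply/fintype.subsetP => i.
  rewrite finset.in_set1; move=> /set_mem /=; rewrite bE.
  by case: ifP => //; rewrite eqxx.
apply: le_trans (ereal_sup_ubound _); last by exists (b t).
rewrite /risk; under eq_integral do rewrite obsb.
apply: (@le_trans _ _ (\int[P]_w ((Num.max 1 (2 * N))%:E * (\1_(E M) w)%:E))%E).
  rewrite ge0_integralZl_EFin//; last first.
  - by rewrite le_max ler01.
  - by apply/measurable_EFinP; exact: measurable_indic.
  rewrite integral_indic// setIT.
  apply: (@le_trans _ _ ((Num.max 1 (2 * N))%:E * 2^-1%:E)%E).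
    rewrite lee_fin -[leLHS](mulKf (x := 2))// mulrC.
    by rewrite ler_pM2r ?invr_gt0// le_max lexx orbT.
  by apply: lee_wpmul2l => //; rewrite lee_fin le_max ler01.
have mloss := measurable_loss (b t) q ef.
apply: ge0_le_integral => //.
- by move=> w _; rewrite mule_ge0 ?lee_fin// le_max ler01.
- by apply: measurable_funeM; apply/measurable_EFinP; exact: measurable_indic.
- by move: mloss; under eq_fun do rewrite obsb.
move=> w _; rewrite -EFinM lee_fin (bigD1 j)//= !mxE !eqxx mulr1.
apply: ler_wpDr; first by apply: sumr_ge0 => i _; exact: powR_ge0.
rewrite indicE; have [/set_mem wE|_] := boolP (w \in E M); last first.
  by rewrite mulr0 powR_ge0.
rewrite mulr1; have le1 : Num.max 1 (2 * N) <= `|g w - t|.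
  move: wE; rewrite /E /= => wE.
  rewrite distrC (le_trans _ (ler_norm _))// lerBrDr (le_trans _ tM)//.
  by rewrite addrC lerD2r (le_trans (ler_norm _)).
apply: (le_trans le1); rewrite -[leLHS]powRr1// ler_powR//.
by rewrite (le_trans _ le1)// le_max lexx.
Qed.

(** * From the risk to errors on the support *)

Section support_test.
Context (a q : R) (f : 'cV[R]_n -> 'cV[R]_p).
Hypotheses (a0 : 0 < a) (q1 : 1 <= q) (ef : estimator f).

Definition support_vec (A : {set 'I_p}) : 'cV[R]_p :=
  \col_j (if j \in A then a else 0).

Definition test_errors (A : {set 'I_p}) (j : 'I_p) : set T :=
  [set w | (a / 2 <= f (obs X sigma xi (support_vec A) w) j ord0) != (j \in A)].

Lemma support_vecU1 (A : {set 'I_p}) (j : 'I_p) : j \notin A ->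
  support_vec (j |: A)%SET = support_vec A + a *: delta_mx j ord0.
Proof.
move=> jA; apply/matrixP => i k; rewrite !mxE ord1 eqxx andbT finset.in_setU1.
have [->|ij] := eqVneq i j; first by rewrite (negbTE jA) add0r mulr1.
by rewrite mulr0 addr0.
Qed.

Lemma support_vec_Omega (A : {set 'I_p}) (s : nat) :
  (#|A| <= s)%N -> Omega p s a (support_vec A).
Proof.
move=> As; split; last first.
  move=> i; rewrite mxE; case: ifP => _; last by rewrite eqxx.
  by rewrite gtr0_norm.
apply: leq_trans As; apply: subset_leq_card; apply/fintype.subsetP => i.
by move=> /set_mem /=; rewrite mxE; case: ifP => //; rewrite eqxx.
Qed.

Lemma cV_borel_test (j : 'I_p) : cV_borel [set y | a / 2 <= f y j ord0].
Proof.
rewrite (_ : [set _ | _] = (fun y => f y j ord0) @^-1` `[a / 2, +oo[).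
  exact: ef.
by apply/seteqP; split => y /=; rewrite in_itv/= andbT.
Qed.

Let mtest (b : 'cV[R]_p) (j : 'I_p) :
  measurable [set w | a / 2 <= f (obs X sigma xi b w) j ord0].
Proof.
apply: (cV_borel_preimage (Y := obs X sigma xi b) _ (cV_borel_test j)) => i.
exact: measurable_obs_coord.
Qed.

Lemma test_errors_in (A : {set 'I_p}) (j : 'I_p) : j \in A -> test_errors A j =
  ~` [set w | a / 2 <= f (obs X sigma xi (support_vec A) w) j ord0].
Proof.
move=> jA; apply/seteqP; split => w; rewrite /test_errors /= jA eqb_id.
  by move/negP.
by move=> /negP.
Qed.

Lemma test_errors_notin (A : {set 'I_p}) (j : 'I_p) : j \notin A -> test_errors A j =
  [set w | a / 2 <= f (obs X sigma xi (support_vec A) w) j ord0].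
Proof.
move=> /negbTE jA; apply/seteqP; split => w; rewrite /test_errors /= jA.
  by rewrite eqbF_neg negbK.
by move=> ->.
Qed.

Lemma measurable_test_errors A j : measurable (test_errors A j).
Proof.
have [jA|jA] := boolP (j \in A); last by rewrite test_errors_notin.
by rewrite test_errors_in//; exact: measurableC.
Qed.

(** A true coordinate is 0 or [a], so an estimate on the wrong side of [a / 2] is off by at least
    [a / 2]; integrate the sum of the corresponding indicators. *)
Lemma risk_ge_test_errors A :
  ((a `^ q * (2 `^ q)^-1 * \sum_(j < p) fine (P (test_errors A j)))%:E <=
   risk P X sigma xi q f (support_vec A))%E.
Proof.
have k0 : 0 <= a `^ q * (2 `^ q)^-1.
  by rewrite mulr_ge0 ?invr_ge0 ?powR_ge0.
have mind j : measurable_fun setT (fun w => (\1_(test_errors A j) w)%:E : \bar R).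
  by apply/measurable_EFinP; exact/measurable_indic/measurable_test_errors.
have -> : ((a `^ q * (2 `^ q)^-1 * \sum_(j < p) fine (P (test_errors A j)))%:E =
    \int[P]_w ((a `^ q * (2 `^ q)^-1)%:E *
      \sum_(j < p) (\1_(test_errors A j) w)%:E))%E.
  rewrite ge0_integralZl_EFin//; last 2 first.
  - by move=> w _; apply: sume_ge0 => j _; rewrite lee_fin.
  - exact: emeasurable_sum.
  rewrite ge0_integral_sum//.
  rewrite EFinM -sumEFin; congr (_ * _)%E; apply: eq_bigr => j _.
  rewrite integral_indic ?setIT//; last exact: measurable_test_errors.
  by rewrite fineK// fin_num_measure//; exact: measurable_test_errors.
apply: ge0_le_integral => //.
- move=> w _; apply: mule_ge0; first by rewrite lee_fin.
  by apply: sume_ge0 => j _; rewrite lee_fin.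
- by apply: measurable_funeM; exact: emeasurable_sum.
- exact: measurable_loss.
move=> w _; rewrite sumEFin -EFinM lee_fin mulr_sumr; apply: ler_sum => j _.
rewrite indicE; have [/set_mem wE|_] := boolP (w \in _); last first.
  by rewrite mulr0 powR_ge0.
have halfE : (2^-1 : R) `^ q = (2 `^ q)^-1.
  by rewrite -powR_inv1// powRAC powR_inv1 ?powR_ge0.
rewrite mulr1 -halfE -powRM ?(ltW a0)//.
apply: ge0_ler_powR; rewrite ?nnegrE ?divr_ge0 ?(ltW a0)//.
  exact: le_trans ler01 q1.
move: wE; have [jA|jA] := boolP (j \in A).
  rewrite test_errors_in// => /negP; rewrite -ltNge mxE jA => fa.
  by rewrite distrC ler_normr; apply/orP; left; lra.
rewrite test_errors_notin//= mxE (negbTE jA) subr0 => fa.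
exact: le_trans fa (ler_norm _).
Qed.

End support_test.

End model.

(** * The minimax lower bound *)

Theorem theorem4 (R : realType) (d : measure_display) (T : measurableType d)
  (P : probability T R) (n p : nat) (X : 'M[R]_(n, p)) (sigma : R)
  (xi : 'I_n -> T -> R) (a q : R) (s : nat) (s' : R) :
  0 < sigma -> iid_std_gaussian P xi ->
  0 < a -> 1 <= q -> (s < p)%N -> 0 < s' -> s' < s%:R ->
  ((a `^ q * (s' / s%:R) *
     ((2 `^ q)^-1 * Psi s a sigma X
      - 2 * s%:R * expR (- (s%:R - s') ^+ 2 / (2 * s%:R))))%:E
   <= ereal_inf [set ereal_sup [set risk P X sigma xi q f b | b in Omega p s a]
                 | f in [set f | @estimator R n p f]])%E.
Proof.
move=> sigma0 hxi a0 q1 sp s'0 s's.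
have sR0 : 0 < s%:R :> R by exact: lt_trans s'0 s's.
have s0 : (0 < s)%N by move: sR0; rewrite ltr0n.
have p0 : 0 < p%:R :> R by rewrite ltr0n (leq_ltn_trans _ sp).
apply: le_ereal_inf_tmp => _ [f ef <-].
(* A zero column makes the maximal risk infinite; afterwards every column norm is positive and [t_j]
   is a genuine threshold. *)
have [[j Kj]|noK] := pselect (exists j, col_norm X j = 0).
  by rewrite (risk_zero_column sigma hxi ef s0 a0 q1 Kj) leey.
have K0 j : 0 < col_norm X j.
  rewrite lt_neqAle sqrtr_ge0 andbT eq_sym; apply/eqP => Kj.
  by apply: noK; exists j.
set M := ereal_sup _.
have riskM (A : {set 'I_p}) : (#|A| <= s)%N ->
    ((a `^ q * (2 `^ q)^-1 * \sum_(j < p)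
      fine (P (test_errors X sigma xi a f A j)))%:E <= M)%E.
  move=> As; apply: le_trans (risk_ge_test_errors X sigma hxi a0 q1 ef A) _.
  by apply: ereal_sup_ubound; exists (support_vec a A) => //;
    exact: (support_vec_Omega a0).
(* The bound at the empty support excludes the value [-oo] for the maximal risk, and [+oo] is
   immediate, which leaves a real [r]. *)
have /riskM : (#|(finset.set0 : {set 'I_p})| <= s)%N by rewrite cards0.
case: M riskM => [r riskM _|_ _|//]; last exact: leey.
pose kappa := a `^ q * (2 `^ q)^-1.
have kappa0 : 0 < kappa by rewrite mulr_gt0 ?invr_gt0 ?powR_gt0.
pose bayes j := s%:R / p%:R *
    gtail sigma ((a - t_j s a sigma X j) * col_norm X j) +
  (1 - s%:R / p%:R) * gtail sigma (t_j s a sigma X j * col_norm X j).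
have bayes01 j : 0 <= bayes j <= s%:R / p%:R.
  apply/andP; split.
    rewrite addr_ge0// mulr_ge0 ?fine_ge0 ?divr_ge0//.
    by rewrite subr_ge0 ler_pdivrMr// mul1r ler_nat ltnW.
  (* The test that never detects [j] has Bayes risk [s / p], which therefore bounds the optimal
     one. *)
  have b0 : cV_borel (set0 : set 'cV[R]_n) by have [] := sigma_algebra_cV_borel R n.
  have := bayes_le_test sigma0 hxi a0 s0 sp 0 (K0 j) b0.
  rewrite [X in fine (P X)](_ : _ = set0)//.
  rewrite [X in _ + _ * fine (P X)](_ : _ = setT); last first.
    by apply/seteqP; split => w //= _; apply.
  by rewrite measure0 probability_setT /= mulr0 mulr1 add0r.
have pairB (A : {set 'I_p}) j : j \notin A -> bayes j <=
    (1 - s%:R / p%:R) * fine (P (test_errors X sigma xi a f A j)) +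
    s%:R / p%:R * fine (P (test_errors X sigma xi a f (j |: A)%SET j)).
  move=> jA; rewrite test_errors_notin// test_errors_in ?finset.setU11//.
  rewrite support_vecU1//.
  exact: (bayes_le_test sigma0 hxi a0 s0 sp _ (K0 j) (cV_borel_test a ef j)).
have := bernoulli_prior_bound s'0 s's sp
  (err := fun A j => fine (P (test_errors X sigma xi a f A j)))
  (M := r / kappa) (fun A j => fine_ge0 (measure_ge0 _ _)) bayes01 pairB.
set delta := expR _ => hb.
have {}hb : s' / s%:R * (Psi s a sigma X - s%:R * delta) <= r / kappa.
  by apply: hb => A As; rewrite ler_pdivlMr// mulrC -lee_fin; exact: riskM.
rewrite lee_fin; move: hb; rewrite ler_pdivlMr//; apply: le_trans.
have -> : s' / s%:R * (Psi s a sigma X - s%:R * delta) * kappa =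
    a `^ q * (s' / s%:R) *
    ((2 `^ q)^-1 * Psi s a sigma X - (2 `^ q)^-1 * (s%:R * delta)).
  by rewrite /kappa; ring.
apply: ler_wpM2l; first by rewrite mulr_ge0 ?powR_ge0 ?divr_ge0 ?ltW.
(* The remaining comparison of constants is that the inverse of the [q]-th power of 2 is at most 1,
   hence at most 2. *)
rewrite lerD2l lerN2 -mulrA; apply: ler_wpM2r.
  by rewrite mulr_ge0 ?expR_ge0.
rewrite (@le_trans _ _ 1)// ?ler1n// invf_le1 ?powR_gt0//.
by rewrite -[leLHS](powRr0 2) ler_powR ?ler1n// (le_trans ler01).
Qed.
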